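(* Let $n \geq 2$. The image $B_n = \Psi_n(\mathrm{U}(W_{\geq -1}))$ contains a principal ideal of $T_n$, namely $T_n v_{n-1}^2$. The ideal $T_n v_{n-1}^2$ is a principal two-sided ideal of $B_n$ (generated as a two-sided ideal of $B_n$ by a single element), but it is not finitely generated as a left ideal of $B_n$, nor as a right ideal of $B_n$.
   Context: Let $\Bbbk$ be a field of characteristic $0$; all algebras are unital $\Bbbk$-algebras and $\otimes=\otimes_\Bbbk$. The one-sided Witt algebra is the Lie algebra $W_{\geq -1}=\Bbbk[t]\partial$, $\partial=\frac{d}{dt}$, with bracket $[f\partial,g\partial]=(fg'-f'g)\partial$. It has basis $e_i=t^{i+1}\partial$ ($i\geq -1$), so $[e_i,e_j]=(j-i)e_{i+j}$. For $n\ge -1$ let $W_{\geq n}=\mathrm{span}_\Bbbk\{e_i\mid i\geq n\}$. For $n\geq 0$ let $\mathfrak g_n=W_{\geq 0}/W_{\geq n}$, with basis $v_i=e_i+W_{\geq n}$, $0\leq i\leq n-1$. $\mathrm U(\cdot)$ denotes the universal enveloping algebra. $A_1$ is the first Weyl algebra, generated by $t,\partial$ with $\partial t-t\partial=1$, and $T_n=A_1\otimes \mathrm U(\mathfrak g_n)$. The $n$th orbit homomorphism is the algebra homomorphism $\Psi_n:\mathrm U(W_{\geq -1})\to T_n$ determined by $\Psi_n(f\partial)=f\partial+\sum_{i=0}^{n-1}\frac{f^{(i+1)}}{(i+1)!}v_i$ for $f\in\Bbbk[t]$. The element $v_{n-1}$ is normal in $T_n$, so $T_nv_{n-1}^2=v_{n-1}^2T_n$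 is a two-sided ideal of $T_n$. *)

(* Defs.v *)
From HB Require Import structures.
From mathcomp Require Import all_boot all_order all_algebra.
From mathcomp Require Import boolp classical_sets.
From mathcomp Require Import ring.

Set Implicit Arguments.
Unset Strict Implicit.
Unset Printing Implicit Defensive.

Import GRing.Theory.
Local Open Scope quotient_scope.
Local Open Scope ring_scope.

(* Algebras given by generators and relations: formal expressions in the      *)
(* generators, modulo the least congruence that contains the relations and    *)
(* the axioms of unital associative k-algebras.                               *)

Inductive aterm (k : fieldType) (X : Type) : Type :=
| aGen of X
| aCst of k
| aAdd of aterm k X & aterm k X
| aMul of aterm k X & aterm k X.
Arguments aGen {k X}.
Arguments aCst {k X}.

HB.instance Definition _ (k : fieldType) (X : Type) :=
  gen_eqMixin (aterm k X).
HB.instance Definition _ (k : fieldType) (X : Type) :=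
  gen_choiceMixin (aterm k X).

Inductive acong (k : fieldType) (X : Type)
    (rel : aterm k X -> aterm k X -> Prop) : aterm k X -> aterm k X -> Prop :=
| acong_rel x y : rel x y -> acong rel x y
| acong_refl x : acong rel x x
| acong_sym x y : acong rel x y -> acong rel y x
| acong_trans x y z : acong rel x y -> acong rel y z -> acong rel x z
| acong_add x x' y y' : acong rel x x' -> acong rel y y' ->
    acong rel (aAdd x y) (aAdd x' y')
| acong_mul x x' y y' : acong rel x x' -> acong rel y y' ->
    acong rel (aMul x y) (aMul x' y')
| acong_addA x y z : acong rel (aAdd x (aAdd y z)) (aAdd (aAdd x y) z)
| acong_addC x y : acong rel (aAdd x y) (aAdd y x)
| acong_add0 x : acong rel (aAdd (aCst 0) x) x
| acong_mulA x y z : acong rel (aMul x (aMul y z)) (aMul (aMul x y) z)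
| acong_mul1 x : acong rel (aMul (aCst 1) x) x
| acong_mulDl x y z :
    acong rel (aMul (aAdd x y) z) (aAdd (aMul x z) (aMul y z))
| acong_mulDr x y z :
    acong rel (aMul x (aAdd y z)) (aAdd (aMul x y) (aMul x z))
| acong_mul0 x : acong rel (aMul (aCst 0) x) (aCst 0)
| acong_cstD a b : acong rel (aCst (a + b)) (aAdd (aCst a) (aCst b))
| acong_cstM a b : acong rel (aCst (a * b)) (aMul (aCst a) (aCst b))
| acong_cstC a x : acong rel (aMul (aCst a) x) (aMul x (aCst a)).

(* The last field is needed because MathComp's algebras are nontrivial.       *)
Record presentation (k : fieldType) := Presentation {
  pgen : Type;
  prel : aterm k pgen -> aterm k pgen -> Prop;
  pres_neq0 : ~ acong prel (aCst 1) (aCst 0)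
}.

Section PresentedAlgebra.
Variables (k : fieldType) (P : presentation k).
Local Notation cg := (acong (@prel k P)).

Definition acongb (x y : aterm k (pgen P)) : bool := `[< cg x y >].

Lemma acongb_equiv : equiv_class_of acongb.
Proof.
split=> [x|x y|y x z].
- by apply/asboolP; exact: acong_refl.
- by apply/asboolP/asboolP => /acong_sym.
- by move=> /asboolP h1 /asboolP h2; apply/asboolP; exact: acong_trans h1 h2.
Qed.

Canonical acong_equiv := EquivRelPack acongb_equiv.

Definition palg : Type := {eq_quot acong_equiv}.
HB.instance Definition _ := Choice.on palg.
HB.instance Definition _ := EqQuotient.on palg.

Definition palg_pi (x : aterm k (pgen P)) : palg := \pi_palg x.

Lemma palg_piP x y : palg_pi x = palg_pi y <-> cg x y.
Proof. by split=> [/eqmodP/asboolP //|h]; apply/eqmodP/asboolP. Qed.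

Lemma palg_reprK (u : palg) : palg_pi (repr u) = u.
Proof. exact: reprK. Qed.

Lemma palg_repr x : cg (repr (palg_pi x)) x.
Proof. by apply/palg_piP; rewrite palg_reprK. Qed.

Definition palg_cst (c : k) : palg := palg_pi (aCst c).
Definition palg_gen (x : pgen P) : palg := palg_pi (aGen x).
Definition palg_add (u v : palg) : palg := palg_pi (aAdd (repr u) (repr v)).
Definition palg_mul (u v : palg) : palg := palg_pi (aMul (repr u) (repr v)).
Definition palg_scale (c : k) (u : palg) : palg :=
  palg_pi (aMul (aCst c) (repr u)).
Definition palg_opp (u : palg) : palg := palg_scale (-1) u.

Lemma palg_addE x y : palg_add (palg_pi x) (palg_pi y) = palg_pi (aAdd x y).
Proof. by apply/palg_piP; apply: acong_add; apply: palg_repr. Qed.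
Lemma palg_mulE x y : palg_mul (palg_pi x) (palg_pi y) = palg_pi (aMul x y).
Proof. by apply/palg_piP; apply: acong_mul; apply: palg_repr. Qed.
Lemma palg_scaleE c x : palg_scale c (palg_pi x) = palg_pi (aMul (aCst c) x).
Proof.
by apply/palg_piP; apply: acong_mul; [exact: acong_refl|apply: palg_repr].
Qed.

Let piE := (palg_addE, palg_mulE, palg_scaleE).

Lemma palg_addA : associative palg_add.
Proof.
move=> u v w; rewrite -[u]palg_reprK -[v]palg_reprK -[w]palg_reprK !piE.
by apply/palg_piP; exact: acong_addA.
Qed.
Lemma palg_addC : commutative palg_add.
Proof.
move=> u v; rewrite -[u]palg_reprK -[v]palg_reprK !piE.
by apply/palg_piP; exact: acong_addC.
Qed.
Lemma palg_add0 : left_id (palg_cst 0) palg_add.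
Proof.
move=> u; rewrite -[u]palg_reprK !piE.
by apply/palg_piP; exact: acong_add0.
Qed.
Lemma palg_addN : left_inverse (palg_cst 0) palg_opp palg_add.
Proof.
move=> u; rewrite -[u]palg_reprK /palg_opp !piE; apply/palg_piP.
apply: (@acong_trans _ _ _ _ (aMul (aCst (-1 + 1)) (repr u))); last first.
  by rewrite addNr; exact: acong_mul0.
apply: acong_sym; apply: acong_trans.
  by apply: acong_mul; [exact: acong_cstD|exact: acong_refl].
apply: acong_trans (acong_mulDl _ _ _ _) _.
by apply: acong_add; [exact: acong_refl|exact: acong_mul1].
Qed.

HB.instance Definition _ :=
  GRing.isZmodule.Build palg palg_addA palg_addC palg_add0 palg_addN.

Lemma palg_mulA : associative palg_mul.
Proof.
move=> u v w; rewrite -[u]palg_reprK -[v]palg_reprK -[w]palg_reprK !piE.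
by apply/palg_piP; exact: acong_mulA.
Qed.
Lemma palg_mul1l : left_id (palg_cst 1) palg_mul.
Proof.
move=> u; rewrite -[u]palg_reprK !piE.
by apply/palg_piP; exact: acong_mul1.
Qed.
Lemma palg_mul1r : right_id (palg_cst 1) palg_mul.
Proof.
move=> u; rewrite -[u]palg_reprK !piE; apply/palg_piP.
by apply: acong_trans (acong_mul1 _ _); exact: acong_sym (acong_cstC _ _ _).
Qed.
Lemma palg_mulDl : left_distributive palg_mul +%R.
Proof.
move=> u v w; rewrite -[u]palg_reprK -[v]palg_reprK -[w]palg_reprK.
rewrite /GRing.add /= !piE.
by apply/palg_piP; exact: acong_mulDl.
Qed.
Lemma palg_mulDr : right_distributive palg_mul +%R.
Proof.
move=> u v w; rewrite -[u]palg_reprK -[v]palg_reprK -[w]palg_reprK.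
rewrite /GRing.add /= !piE.
by apply/palg_piP; exact: acong_mulDr.
Qed.
Lemma palg_neq0 : palg_cst 1 != 0.
Proof. by apply/eqP => /palg_piP; exact: pres_neq0. Qed.

HB.instance Definition _ := GRing.Zmodule_isNzRing.Build palg
  palg_mulA palg_mul1l palg_mul1r palg_mulDl palg_mulDr palg_neq0.

Lemma palg_scale_mul c u : palg_scale c u = palg_cst c * u.
Proof. by rewrite -[u]palg_reprK /GRing.mul /= !piE. Qed.
Lemma palg_cstD a b : palg_cst (a + b) = palg_cst a + palg_cst b.
Proof.
by rewrite /GRing.add /= !piE; apply/palg_piP; exact: acong_cstD.
Qed.
Lemma palg_cstM a b : palg_cst (a * b) = palg_cst a * palg_cst b.
Proof.
by rewrite /GRing.mul /= !piE; apply/palg_piP; exact: acong_cstM.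
Qed.
Lemma palg_cstC a u : palg_cst a * u = u * palg_cst a.
Proof.
rewrite -[u]palg_reprK /GRing.mul /= !piE.
by apply/palg_piP; exact: acong_cstC.
Qed.

Lemma palg_scaleA a b u : palg_scale a (palg_scale b u) = palg_scale (a * b) u.
Proof. by rewrite !palg_scale_mul palg_cstM mulrA. Qed.
Lemma palg_scale1 : left_id 1 palg_scale.
Proof. by move=> u; rewrite palg_scale_mul; exact: palg_mul1l. Qed.
Lemma palg_scaleDr : right_distributive palg_scale +%R.
Proof. by move=> a u v; rewrite !palg_scale_mul mulrDr. Qed.
Lemma palg_scaleDl u : {morph palg_scale^~ u : a b / a + b}.
Proof. by move=> a b; rewrite !palg_scale_mul palg_cstD mulrDl. Qed.

HB.instance Definition _ := GRing.Zmodule_isLmodule.Build k palg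
  palg_scaleA palg_scale1 palg_scaleDr palg_scaleDl.

Lemma palg_scaleAl (a : k) (u v : palg) : a *: (u * v) = (a *: u) * v.
Proof. by rewrite /GRing.scale /= !palg_scale_mul mulrA. Qed.
HB.instance Definition _ := GRing.Lmodule_isLalgebra.Build k palg palg_scaleAl.
Lemma palg_scaleAr (a : k) (u v : palg) : a *: (u * v) = u * (a *: v).
Proof. by rewrite /GRing.scale /= !palg_scale_mul mulrA palg_cstC mulrA. Qed.
HB.instance Definition _ := GRing.Lalgebra_isAlgebra.Build k palg palg_scaleAr.

Lemma palg_piD x y : palg_pi (aAdd x y) = palg_pi x + palg_pi y.
Proof. by rewrite -palg_addE. Qed.
Lemma palg_piM x y : palg_pi (aMul x y) = palg_pi x * palg_pi y.
Proof. by rewrite -palg_mulE. Qed.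
Lemma palg_piZ c x : palg_pi (aMul (aCst c) x) = c *: palg_pi x.
Proof. by rewrite -palg_scaleE. Qed.
Lemma palg_piC c : palg_pi (aCst c) = c%:A.
Proof.
rewrite -[c%:A]/(palg_scale c (palg_cst 1)) palg_scale_mul -[LHS]/(palg_cst c).
by rewrite [RHS]palg_mul1r.
Qed.

End PresentedAlgebra.

Section Lift.
Variables (k : fieldType) (A : algType k).

Fixpoint aeval (X : Type) (f : X -> A) (x : aterm k X) : A :=
  match x with
  | aGen g => f g
  | aCst c => c%:A
  | aAdd y z => aeval f y + aeval f z
  | aMul y z => aeval f y * aeval f z
  end.

Variables (P : presentation k) (f : pgen P -> A).
Hypothesis frel : forall x y, prel x y -> aeval f x = aeval f y.

Lemma aeval_cong x y : acong (@prel k P) x y -> aeval f x = aeval f y.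
Proof.
elim=> {x y} //=.
- by move=> x y z _ -> _ ->.
- by move=> x x' y y' _ -> _ ->.
- by move=> x x' y y' _ -> _ ->.
- by move=> x y z; rewrite addrA.
- by move=> x y; rewrite addrC.
- by move=> x; rewrite scale0r add0r.
- by move=> x y z; rewrite mulrA.
- by move=> x; rewrite scale1r mul1r.
- by move=> x y z; rewrite mulrDl.
- by move=> x y z; rewrite mulrDr.
- by move=> x; rewrite scale0r mul0r.
- by move=> a b; rewrite scalerDl.
- by move=> a b; rewrite -scalerAl mul1r scalerA.
- by move=> a x; rewrite -scalerAl -scalerAr mul1r mulr1.
Qed.

Definition palg_lift_fun (u : palg P) : A := aeval f (repr u).

Lemma palg_lift_pi x : palg_lift_fun (palg_pi x) = aeval f x.
Proof. by apply: aeval_cong; exact: palg_repr. Qed.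

Lemma palg_lift_linear : linear palg_lift_fun.
Proof.
move=> c u v; rewrite -[u]palg_reprK -[v]palg_reprK.
rewrite -[c *: _]/(palg_scale c (palg_pi _)) palg_scaleE -palg_piD.
by rewrite !palg_lift_pi /= -scalerAl mul1r.
Qed.

Lemma palg_lift_monoid : monoid_morphism palg_lift_fun.
Proof.
split=> [|u v]; first by rewrite -[1]/(palg_pi (aCst 1)) palg_lift_pi /= scale1r.
by rewrite -[u]palg_reprK -[v]palg_reprK -palg_piM !palg_lift_pi.
Qed.

HB.instance Definition _ :=
  GRing.isLinear.Build k (palg P) A _ palg_lift_fun palg_lift_linear.
HB.instance Definition _ :=
  GRing.isMonoidMorphism.Build (palg P) A palg_lift_fun palg_lift_monoid.

Definition palg_lift : {lrmorphism palg P -> A} := palg_lift_fun.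

Lemma palg_lift_gen g : palg_lift (palg_gen g) = f g.
Proof. exact: palg_lift_pi. Qed.

End Lift.

(* Modules over presented algebras; used to check nontriviality.              *)
Section Act.
Variables (k : fieldType) (X : Type) (V : lmodType k) (rho : X -> V -> V).
Hypothesis rho_lin : forall g, linear (rho g).

Fixpoint aact (x : aterm k X) (v : V) : V :=
  match x with
  | aGen g => rho g v
  | aCst c => c *: v
  | aAdd y z => aact y v + aact z v
  | aMul y z => aact y (aact z v)
  end.

Lemma aact_linear x : linear (aact x).
Proof.
elim: x => [g|c|x IHx y IHy|x IHx y IHy] a u v /=.
- exact: rho_lin.
- by rewrite scalerDr !scalerA mulrC.
- by rewrite IHx IHy scalerDr addrACA.
- by rewrite IHy IHx.
Qed.

Variable rel : aterm k X -> aterm k X -> Prop.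
Hypothesis rho_rel : forall x y, rel x y -> aact x =1 aact y.

Lemma aactD x u v : aact x (u + v) = aact x u + aact x v.
Proof. by have := aact_linear x 1 u v; rewrite !scale1r. Qed.
Lemma aact0 x : aact x 0 = 0.
Proof. by apply: (addIr (aact x 0)); rewrite -aactD !add0r. Qed.
Lemma aactZ x c u : aact x (c *: u) = c *: aact x u.
Proof. by have := aact_linear x c u 0; rewrite aact0 !addr0. Qed.

Lemma aact_cong x y : acong rel x y -> aact x =1 aact y.
Proof.
elim=> {x y} /=.
- exact: rho_rel.
- by [].
- by move=> x y _ IH v; rewrite IH.
- by move=> x y z _ IH1 _ IH2 v; rewrite IH1.
- by move=> x x' y y' _ IH1 _ IH2 v; rewrite /= IH1 IH2.
- by move=> x x' y y' _ IH1 _ IH2 v; rewrite /= IH1 IH2.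
- by move=> x y z v /=; rewrite addrA.
- by move=> x y v /=; rewrite addrC.
- by move=> x v /=; rewrite scale0r add0r.
- by [].
- by move=> x v /=; rewrite scale1r.
- by [].
- by move=> x y z v /=; rewrite aactD.
- by move=> x v /=; rewrite !scale0r.
- by move=> a b v /=; rewrite scalerDl.
- by move=> a b v /=; rewrite scalerA.
- by move=> a x v /=; rewrite aactZ.
Qed.

Lemma acong_neq0 (v : V) : v != 0 -> ~ acong rel (aCst 1) (aCst 0).
Proof. by move=> /eqP v0 /aact_cong/(_ v) /=; rewrite scale1r scale0r. Qed.

End Act.

Section WeylAlgebra.
Variable k : fieldType.

Inductive weyl_gen := weyl_gt | weyl_gd.

Inductive weyl_rel : aterm k weyl_gen -> aterm k weyl_gen -> Prop :=
| weyl_rel_dt : weyl_rel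
    (aMul (aGen weyl_gd) (aGen weyl_gt))
    (aAdd (aMul (aGen weyl_gt) (aGen weyl_gd)) (aCst 1)).

Definition weyl_act (g : weyl_gen) (p : {poly k}) : {poly k} :=
  match g with weyl_gt => 'X * p | weyl_gd => p^`() end.

Lemma weyl_pres_neq0 : ~ acong weyl_rel (aCst 1) (aCst 0).
Proof.
apply: (@acong_neq0 _ _ {poly k} weyl_act _ _ _ 1); last exact: oner_neq0.
- by case=> a p q /=; [rewrite mulrDr -scalerAr|rewrite derivD derivZ].
- move=> x y [] p /=; rewrite derivM derivX mul1r scale1r addrC.
  by [].
Qed.

Definition weyl : algType k := palg (Presentation weyl_pres_neq0).
Definition weyl_t : weyl := palg_gen (P := Presentation weyl_pres_neq0) weyl_gt.
Definition weyl_d : weyl := palg_gen (P := Presentation weyl_pres_neq0) weyl_gd.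

Lemma weyl_dt : weyl_d * weyl_t - weyl_t * weyl_d = 1.
Proof.
apply/eqP; rewrite subr_eq addrC; apply/eqP.
rewrite -!palg_piM -[1]/(palg_pi (aCst 1)) -palg_piD.
by apply/palg_piP; apply: acong_rel.
Qed.

End WeylAlgebra.

HB.mixin Record Lmodule_isLie (k : fieldType) L of GRing.Lmodule k L := {
  lie : L -> L -> L;
  lieDl : forall x y z, lie (x + y) z = lie x z + lie y z;
  lieDr : forall x y z, lie x (y + z) = lie x y + lie x z;
  lieZl : forall a x y, lie (a *: x) y = a *: lie x y;
  lieZr : forall a x y, lie x (a *: y) = a *: lie x y;
  liexx : forall x, lie x x = 0;
  lie_jacobi : forall x y z,
    lie x (lie y z) + lie y (lie z x) + lie z (lie x y) = 0
}.

#[short(type="lieType")]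
HB.structure Definition Lie (k : fieldType) :=
  {L of GRing.Lmodule k L & Lmodule_isLie k L}.

Section Enveloping.
Variables (k : fieldType) (L : lieType k).

Inductive uea_rel : aterm k L -> aterm k L -> Prop :=
| uea_rel_lin a x y : uea_rel
    (aGen (a *: x + y)) (aAdd (aMul (aCst a) (aGen x)) (aGen y))
| uea_rel_lie x y : uea_rel
    (aMul (aGen x) (aGen y)) (aAdd (aMul (aGen y) (aGen x)) (aGen (lie x y))).

Lemma uea_pres_neq0 : ~ acong uea_rel (aCst 1) (aCst 0).
Proof.
apply: (@acong_neq0 _ _ k^o (fun _ _ => 0) _ _ _ 1); last exact: oner_neq0.
- by move=> g a p q; rewrite scaler0 addr0.
- by move=> x y [] * /=; rewrite ?scaler0 ?addr0.
Qed.

Definition uea : algType k := palg (Presentation uea_pres_neq0).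
Definition uea_inj (x : L) : uea :=
  palg_gen (P := Presentation uea_pres_neq0) x.

Lemma uea_inj_linear : linear uea_inj.
Proof.
move=> a x y.
rewrite -palg_piZ -palg_piD.
by apply/palg_piP; apply: acong_rel; exact: uea_rel_lin.
Qed.
HB.instance Definition _ :=
  GRing.isLinear.Build k L uea _ uea_inj uea_inj_linear.

Lemma uea_inj_lie x y :
  uea_inj (lie x y) = uea_inj x * uea_inj y - uea_inj y * uea_inj x.
Proof.
apply/eqP; rewrite eq_sym subr_eq addrC; apply/eqP.
rewrite -!palg_piM -palg_piD.
by apply/palg_piP; apply: acong_rel; exact: uea_rel_lie.
Qed.

Variables (A : algType k) (f : L -> A).
Hypothesis flin : linear f.
Hypothesis flie : forall x y, f (lie x y) = f x * f y - f y * f x.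

Lemma uea_lift_rel x y : uea_rel x y -> aeval f x = aeval f y.
Proof.
case=> [a u v|u v] /=; first by rewrite flin -scalerAl mul1r.
by rewrite flie addrC subrK.
Qed.

Definition uea_lift : {lrmorphism uea -> A} :=
  palg_lift (P := Presentation uea_pres_neq0) uea_lift_rel.

Lemma uea_lift_inj x : uea_lift (uea_inj x) = f x.
Proof. exact: palg_lift_gen. Qed.

End Enveloping.

(* The polynomial f stands for the vector field f d/dt.                       *)
Definition witt (k : fieldType) : Type := {poly k}.
HB.instance Definition _ (k : fieldType) := GRing.Lmodule.on (witt k).

Section Witt.
Variable k : fieldType.

Definition witt_lie (f g : {poly k}) : {poly k} := f * g^`() - f^`() * g.

Lemma witt_lieDl (f g h : witt k) :
  witt_lie (f + g) h = witt_lie f h + witt_lie g h.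
Proof. by rewrite /witt_lie [(f + g)^`()]derivD; ring. Qed.
Lemma witt_lieDr (f g h : witt k) :
  witt_lie f (g + h) = witt_lie f g + witt_lie f h.
Proof. by rewrite /witt_lie [(g + h)^`()]derivD; ring. Qed.
Lemma witt_lieZl a (f g : witt k) : witt_lie (a *: f) g = a *: witt_lie f g.
Proof. by rewrite /witt_lie [(a *: f)^`()]derivZ -!scalerAl scalerBr. Qed.
Lemma witt_lieZr a (f g : witt k) : witt_lie f (a *: g) = a *: witt_lie f g.
Proof. by rewrite /witt_lie [(a *: g)^`()]derivZ -!scalerAr scalerBr. Qed.
Lemma witt_liexx f : witt_lie f f = 0.
Proof. by rewrite /witt_lie mulrC subrr. Qed.
Lemma witt_lie_jacobi f g h :
  witt_lie f (witt_lie g h) + witt_lie g (witt_lie h f)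
    + witt_lie h (witt_lie f g) = 0.
Proof. by rewrite /witt_lie !(derivD, derivN, derivM); ring. Qed.

HB.instance Definition _ := Lmodule_isLie.Build k (witt k)
  witt_lieDl witt_lieDr witt_lieZl witt_lieZr witt_liexx witt_lie_jacobi.

Lemma dvdXn_lie m (f g : {poly k}) :
  'X %| f -> 'X^m %| g -> 'X^m %| witt_lie f g.
Proof.
move=> /dvdpP[p ->] hg; apply: dvdp_sub; last exact: dvdp_mull.
have /dvdpP[q ->] := hg; case: m hg => [|m] _; first by rewrite expr0 dvd1p.
rewrite derivM derivXn /= -mulr_natr exprS.
by apply/dvdpP; exists (p * q^`() * 'X + p * q * m.+1%:R); ring.
Qed.

(* W_{>= m-1}, spanned by the e_i = 'X^(i.+1) with i.+1 >= m.                 *)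
Definition wittge_pred (m : nat) : {pred witt k} :=
  fun f : {poly k} => 'X^m %| f.

Lemma wittge_submod m : subsemimod_closed (wittge_pred m).
Proof.
split; [split=> [|f g]|move=> a f]; rewrite !unfold_in /=.
- exact: dvdp0.
- exact: dvdp_add.
- by move=> h; rewrite -[a *: f]mul_polyC; exact: dvdp_mull.
Qed.

End Witt.

HB.instance Definition _ (k : fieldType) (m : nat) :=
  GRing.isSubmodClosed.Build k (witt k) (@wittge_pred k m) (@wittge_submod k m).

Record wittge0 (k : fieldType) : Type :=
  Wittge0 { wittge0_val :> witt k; _ : wittge0_val \in @wittge_pred k 1 }.

HB.instance Definition _ (k : fieldType) :=
  [isSub for @wittge0_val k].
HB.instance Definition _ (k : fieldType) := [Choice of wittge0 k by <:].
HB.instance Definition _ (k : fieldType) :=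
  [SubChoice_isSubLmodule of wittge0 k by <:].
Section WittSubquotient.
Variable k : fieldType.
Implicit Types f g h : wittge0 k.

Lemma wittge0_lie_subproof f g :
  lie (val f) (val g) \in @wittge_pred k 1.
Proof.
case: f g => [f hf] [g hg].
have h : 'X %| (f : {poly k}) by rewrite -['X]expr1; exact: hf.
exact: dvdXn_lie h hg.
Qed.
Definition wittge0_lie f g : wittge0 k :=
  Wittge0 (wittge0_lie_subproof f g).

Lemma wittge0_lieDl f g h :
  wittge0_lie (f + g) h = wittge0_lie f h + wittge0_lie g h.
Proof. by apply: val_inj; exact: lieDl. Qed.
Lemma wittge0_lieDr f g h :
  wittge0_lie f (g + h) = wittge0_lie f g + wittge0_lie f h.
Proof. by apply: val_inj; exact: lieDr. Qed.
Lemma wittge0_lieZl a f g : wittge0_lie (a *: f) g = a *: wittge0_lie f g.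
Proof. by apply: val_inj; exact: lieZl. Qed.
Lemma wittge0_lieZr a f g : wittge0_lie f (a *: g) = a *: wittge0_lie f g.
Proof. by apply: val_inj; exact: lieZr. Qed.
Lemma wittge0_liexx f : wittge0_lie f f = 0.
Proof. by apply: val_inj; exact: liexx. Qed.
Lemma wittge0_lie_jacobi f g h :
  wittge0_lie f (wittge0_lie g h) + wittge0_lie g (wittge0_lie h f)
    + wittge0_lie h (wittge0_lie f g) = 0.
Proof. by apply: val_inj; exact: lie_jacobi. Qed.

HB.instance Definition _ := Lmodule_isLie.Build k (wittge0 k)
  wittge0_lieDl wittge0_lieDr wittge0_lieZl wittge0_lieZr wittge0_liexx
  wittge0_lie_jacobi.

Definition wittge_ideal (n : nat) : {pred wittge0 k} :=
  fun f => val f \in @wittge_pred k n.+1.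

Lemma wittge_ideal_submod n : subsemimod_closed (wittge_ideal n).
Proof.
split; [split=> [|f g]|move=> a f]; rewrite !unfold_in.
- exact: (@rpred0 _ (@wittge_pred k n.+1)).
- exact: (@rpredD _ (@wittge_pred k n.+1)).
- exact: (@rpredZ _ _ (@wittge_pred k n.+1)).
Qed.
HB.instance Definition _ n :=
  GRing.isSubmodClosed.Build k (wittge0 k) (wittge_ideal n)
    (@wittge_ideal_submod n).

Lemma wittge_ideal_lier n f g :
  g \in wittge_ideal n -> lie f g \in wittge_ideal n.
Proof.
case: f g => [f hf] [g hg] hgn.
have h : 'X %| (f : {poly k}) by rewrite -['X]expr1; exact: hf.
exact: dvdXn_lie h hgn.
Qed.

Lemma wittge0_lieC f g : lie f g = - lie g f.
Proof.
have := liexx (f + g); rewrite lieDl !lieDr !liexx add0r addr0 => /eqP.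
by rewrite addr_eq0 => /eqP.
Qed.

Lemma wittge_ideal_liel n f g :
  f \in wittge_ideal n -> lie f g \in wittge_ideal n.
Proof. by move=> hf; rewrite wittge0_lieC rpredN wittge_ideal_lier. Qed.

(* W_{>=0} / W_{>=n}, with v_i given by gv i below.                           *)
Definition gquot (n : nat) : Type := {ideal_quot (wittge_ideal n)}.
HB.instance Definition _ n := GRing.Zmodule.on (gquot n).
HB.instance Definition _ n := EqQuotient.on (gquot n).

Variable n : nat.
Definition gpi (f : wittge0 k) : gquot n := \pi f.

Lemma gpiP f g : gpi f = gpi g <-> f - g \in wittge_ideal n.
Proof. by split=> [/eqmodP|h] //; apply/eqmodP. Qed.
Lemma gpi_reprK (u : gquot n) : gpi (repr u) = u.
Proof. exact: reprK. Qed.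
Lemma gpi_repr f : repr (gpi f) - f \in wittge_ideal n.
Proof. by apply/gpiP; rewrite gpi_reprK. Qed.
Lemma gpiD f g : gpi (f + g) = gpi f + gpi g.
Proof. exact: (raddfD (\pi_({ideal_quot (wittge_ideal n)}))). Qed.

Definition gscale (a : k) (u : gquot n) : gquot n := gpi (a *: repr u).
Definition glie (u v : gquot n) : gquot n := gpi (lie (repr u) (repr v)).

Lemma gscaleE a f : gscale a (gpi f) = gpi (a *: f).
Proof. by apply/gpiP; rewrite -scalerBr rpredZ ?gpi_repr. Qed.

Lemma glieE f g : glie (gpi f) (gpi g) = gpi (lie f g).
Proof.
apply/gpiP; set f' := repr _; set g' := repr _.
have -> : lie f' g' - lie f g = lie (f' - f) g' + lie f (g' - g).
  by rewrite lieDl lieDr -!scaleN1r lieZl lieZr !scaleN1r addrA addrNK.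
by apply: rpredD; [apply: wittge_ideal_liel|apply: wittge_ideal_lier];
  exact: gpi_repr.
Qed.

Lemma gscaleA a b u : gscale a (gscale b u) = gscale (a * b) u.
Proof. by rewrite -[u]gpi_reprK !gscaleE scalerA. Qed.
Lemma gscale1 : left_id 1 gscale.
Proof. by move=> u; rewrite -[u]gpi_reprK !gscaleE scale1r. Qed.
Lemma gscaleDr : right_distributive gscale +%R.
Proof.
move=> a u v; rewrite -[u]gpi_reprK -[v]gpi_reprK -gpiD !gscaleE.
by rewrite scalerDr gpiD.
Qed.
Lemma gscaleDl u : {morph gscale^~ u : a b / a + b}.
Proof. by move=> a b; rewrite -[u]gpi_reprK !gscaleE scalerDl gpiD. Qed.
HB.instance Definition _ := GRing.Zmodule_isLmodule.Build k (gquot n)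
  gscaleA gscale1 gscaleDr gscaleDl.

Lemma gpiZ a f : gpi (a *: f) = a *: gpi f.
Proof. by rewrite -gscaleE. Qed.
Lemma gpi0 : gpi 0 = 0.
Proof. by have := gpiZ 0 0; rewrite !scale0r. Qed.

Lemma glieDl u v w : glie (u + v) w = glie u w + glie v w.
Proof.
rewrite -[u]gpi_reprK -[v]gpi_reprK -[w]gpi_reprK.
by rewrite -gpiD !glieE lieDl gpiD.
Qed.
Lemma glieDr u v w : glie u (v + w) = glie u v + glie u w.
Proof.
rewrite -[u]gpi_reprK -[v]gpi_reprK -[w]gpi_reprK.
by rewrite -gpiD !glieE lieDr gpiD.
Qed.
Lemma glieZl a u v : glie (a *: u) v = a *: glie u v.
Proof.
by rewrite -[u]gpi_reprK -[v]gpi_reprK -gpiZ !glieE lieZl gpiZ.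
Qed.
Lemma glieZr a u v : glie u (a *: v) = a *: glie u v.
Proof.
by rewrite -[u]gpi_reprK -[v]gpi_reprK -gpiZ !glieE lieZr gpiZ.
Qed.
Lemma gliexx u : glie u u = 0.
Proof. by rewrite -[u]gpi_reprK glieE liexx gpi0. Qed.
Lemma glie_jacobi u v w :
  glie u (glie v w) + glie v (glie w u) + glie w (glie u v) = 0.
Proof.
rewrite -[u]gpi_reprK -[v]gpi_reprK -[w]gpi_reprK !glieE -!gpiD.
by rewrite lie_jacobi gpi0.
Qed.
HB.instance Definition _ := Lmodule_isLie.Build k (gquot n)
  glieDl glieDr glieZl glieZr gliexx glie_jacobi.

Lemma witt_e_subproof (i : nat) : ('X^(i.+1) : witt k) \in @wittge_pred k 1.
Proof. by rewrite unfold_in /= dvdp_exp2l. Qed.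
Definition witt_e (i : nat) : wittge0 k := Wittge0 (witt_e_subproof i).

Definition gv (i : nat) : gquot n := gpi (witt_e i).

Lemma gv_lie i j :
  lie (gv i) (gv j) = (j%:R - i%:R) *: gv (i + j).
Proof.
rewrite -[LHS]/(glie _ _) glieE -gpiZ; congr gpi; apply: val_inj.
rewrite -[LHS]/(witt_lie ('X^(i.+1)) ('X^(j.+1))).
rewrite -[RHS]/((j%:R - i%:R) *: 'X^((i + j).+1) : {poly k}).
rewrite /witt_lie !derivXn /= mulrnAl mulrnAr -!exprD addSn addnS.
by rewrite scalerBl !scaler_nat !mulrS opprD addrACA subrr add0r.
Qed.

Lemma gv_eq0 i : (n <= i)%N -> gv i = 0.
Proof.
move=> hi; rewrite -gpi0; apply/gpiP; rewrite subr0 unfold_in unfold_in /=.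
by rewrite dvdp_exp2l.
Qed.

End WittSubquotient.

(* The tensor product of vector spaces: formal linear combinations of pure    *)
(* tensors modulo bilinearity.                                                *)

Inductive tterm (k : fieldType) (A B : Type) : Type :=
| tPure of A & B
| tAdd of tterm k A B & tterm k A B
| tScale of k & tterm k A B.
Arguments tPure {k A B}.

HB.instance Definition _ (k : fieldType) (A B : Type) :=
  gen_eqMixin (tterm k A B).
HB.instance Definition _ (k : fieldType) (A B : Type) :=
  gen_choiceMixin (tterm k A B).

Inductive tcong (k : fieldType) (A B : lmodType k) :
    tterm k A B -> tterm k A B -> Prop :=
| tcong_refl x : tcong x x
| tcong_sym x y : tcong x y -> tcong y x
| tcong_trans x y z : tcong x y -> tcong y z -> tcong x z
| tcong_add x x' y y' : tcong x x' -> tcong y y' ->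
    tcong (tAdd x y) (tAdd x' y')
| tcong_scale c x x' : tcong x x' -> tcong (tScale c x) (tScale c x')
| tcong_addA x y z : tcong (tAdd x (tAdd y z)) (tAdd (tAdd x y) z)
| tcong_addC x y : tcong (tAdd x y) (tAdd y x)
| tcong_add0 x : tcong (tAdd (tPure 0 0) x) x
| tcong_scaleA c d x : tcong (tScale c (tScale d x)) (tScale (c * d) x)
| tcong_scale1 x : tcong (tScale 1 x) x
| tcong_scale0 x : tcong (tScale 0 x) (tPure 0 0)
| tcong_scaleDr c x y :
    tcong (tScale c (tAdd x y)) (tAdd (tScale c x) (tScale c y))
| tcong_scaleDl c d x :
    tcong (tScale (c + d) x) (tAdd (tScale c x) (tScale d x))
| tcong_linl c a a' b :
    tcong (tPure (c *: a + a') b) (tAdd (tScale c (tPure a b)) (tPure a' b))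
| tcong_linr c a b b' :
    tcong (tPure a (c *: b + b')) (tAdd (tScale c (tPure a b)) (tPure a b')).

Section Tensor.
Variables (k : fieldType) (A B : lmodType k).
Local Notation cg := (@tcong k A B).

Definition tcongb (x y : tterm k A B) : bool := `[< cg x y >].

Lemma tcongb_equiv : equiv_class_of tcongb.
Proof.
split=> [x|x y|y x z].
- by apply/asboolP; exact: tcong_refl.
- by apply/asboolP/asboolP => /tcong_sym.
- by move=> /asboolP h1 /asboolP h2; apply/asboolP; exact: tcong_trans h1 h2.
Qed.

Canonical tcong_equiv := EquivRelPack tcongb_equiv.

Definition tensor : Type := {eq_quot tcong_equiv}.
HB.instance Definition _ := Choice.on tensor.
HB.instance Definition _ := EqQuotient.on tensor.

Definition tensor_pi (x : tterm k A B) : tensor := \pi_tensor x.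

Lemma tensor_piP x y : tensor_pi x = tensor_pi y <-> cg x y.
Proof. by split=> [/eqmodP/asboolP //|h]; apply/eqmodP/asboolP. Qed.

Lemma tensor_reprK (u : tensor) : tensor_pi (repr u) = u.
Proof. exact: reprK. Qed.

Lemma tensor_repr x : cg (repr (tensor_pi x)) x.
Proof. by apply/tensor_piP; rewrite tensor_reprK. Qed.

Definition tpure (a : A) (b : B) : tensor := tensor_pi (tPure a b).
Definition tensor_add (u v : tensor) : tensor :=
  tensor_pi (tAdd (repr u) (repr v)).
Definition tensor_scale (c : k) (u : tensor) : tensor :=
  tensor_pi (tScale c (repr u)).
Definition tensor_opp (u : tensor) : tensor := tensor_scale (-1) u.

Lemma tensor_addE x y :
  tensor_add (tensor_pi x) (tensor_pi y) = tensor_pi (tAdd x y).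
Proof. by apply/tensor_piP; apply: tcong_add; apply: tensor_repr. Qed.
Lemma tensor_scaleE c x :
  tensor_scale c (tensor_pi x) = tensor_pi (tScale c x).
Proof. by apply/tensor_piP; apply: tcong_scale; apply: tensor_repr. Qed.

Let piE := (tensor_addE, tensor_scaleE).

Lemma tensor_addA : associative tensor_add.
Proof.
move=> u v w; rewrite -[u]tensor_reprK -[v]tensor_reprK -[w]tensor_reprK !piE.
by apply/tensor_piP; exact: tcong_addA.
Qed.
Lemma tensor_addC : commutative tensor_add.
Proof.
move=> u v; rewrite -[u]tensor_reprK -[v]tensor_reprK !piE.
by apply/tensor_piP; exact: tcong_addC.
Qed.
Lemma tensor_add0 : left_id (tpure 0 0) tensor_add.
Proof.
by move=> u; rewrite -[u]tensor_reprK !piE; apply/tensor_piP; exact: tcong_add0.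
Qed.
Lemma tensor_scaleA a b u :
  tensor_scale a (tensor_scale b u) = tensor_scale (a * b) u.
Proof.
by rewrite -[u]tensor_reprK !piE; apply/tensor_piP; exact: tcong_scaleA.
Qed.
Lemma tensor_scale1 : left_id 1 tensor_scale.
Proof.
by move=> u; rewrite -[u]tensor_reprK piE; apply/tensor_piP; exact: tcong_scale1.
Qed.
Lemma tensor_scale_addr a u v : tensor_scale a (tensor_add u v) =
  tensor_add (tensor_scale a u) (tensor_scale a v).
Proof.
rewrite -[u]tensor_reprK -[v]tensor_reprK !piE.
by apply/tensor_piP; exact: tcong_scaleDr.
Qed.
Lemma tensor_scale_addl a b u : tensor_scale (a + b) u =
  tensor_add (tensor_scale a u) (tensor_scale b u).
Proof.
by rewrite -[u]tensor_reprK !piE; apply/tensor_piP; exact: tcong_scaleDl.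
Qed.
Lemma tensor_addN : left_inverse (tpure 0 0) tensor_opp tensor_add.
Proof.
move=> u; rewrite /tensor_opp -{2}[u]tensor_scale1 -tensor_scale_addl addNr.
by rewrite -[u]tensor_reprK piE; apply/tensor_piP; exact: tcong_scale0.
Qed.

HB.instance Definition _ :=
  GRing.isZmodule.Build tensor tensor_addA tensor_addC tensor_add0 tensor_addN.

Lemma tensor_scaleDl u : {morph tensor_scale^~ u : a b / a + b}.
Proof. by move=> a b; exact: tensor_scale_addl. Qed.

HB.instance Definition _ := GRing.Zmodule_isLmodule.Build k tensor
  tensor_scaleA tensor_scale1 tensor_scale_addr tensor_scaleDl.

Lemma tensor_piD x y : tensor_pi (tAdd x y) = tensor_pi x + tensor_pi y.
Proof. by rewrite -tensor_addE. Qed.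
Lemma tensor_piZ c x : tensor_pi (tScale c x) = c *: tensor_pi x.
Proof. by rewrite -tensor_scaleE. Qed.

Lemma tpure_linl c a a' b :
  tpure (c *: a + a') b = c *: tpure a b + tpure a' b.
Proof.
by rewrite -tensor_piZ -tensor_piD; apply/tensor_piP; exact: tcong_linl.
Qed.
Lemma tpure_linr c a b b' :
  tpure a (c *: b + b') = c *: tpure a b + tpure a b'.
Proof.
by rewrite -tensor_piZ -tensor_piD; apply/tensor_piP; exact: tcong_linr.
Qed.
Lemma tpureDl a a' b : tpure (a + a') b = tpure a b + tpure a' b.
Proof. by have := tpure_linl 1 a a' b; rewrite !scale1r. Qed.
Lemma tpureDr a b b' : tpure a (b + b') = tpure a b + tpure a b'.
Proof. by have := tpure_linr 1 a b b'; rewrite !scale1r. Qed.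
Lemma tpure0l b : tpure 0 b = 0.
Proof. by apply: (addIr (tpure 0 b)); rewrite -tpureDl !add0r. Qed.
Lemma tpure0r a : tpure a 0 = 0.
Proof. by apply: (addIr (tpure a 0)); rewrite -tpureDr !add0r. Qed.
Lemma tpureZl c a b : tpure (c *: a) b = c *: tpure a b.
Proof. by have := tpure_linl c a 0 b; rewrite tpure0l !addr0. Qed.
Lemma tpureZr c a b : tpure a (c *: b) = c *: tpure a b.
Proof. by have := tpure_linr c a b 0; rewrite tpure0r !addr0. Qed.

Lemma tensor_ind (Q : tensor -> Prop) :
  (forall a b, Q (tpure a b)) -> (forall u v, Q u -> Q v -> Q (u + v)) ->
  forall u, Q u.
Proof.
move=> Qp QD u; rewrite -[u]tensor_reprK.
suff: forall c, Q (c *: tensor_pi (repr u)) by move=> /(_ 1); rewrite scale1r.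
elim: (repr u) => [a b|x IHx y IHy|d x IHx] c.
- by rewrite -tpureZl; exact: Qp.
- by rewrite tensor_piD scalerDr; exact: QD.
- by rewrite tensor_piZ scalerA.
Qed.

Section TensorLift.
Variables (V : lmodType k) (beta : A -> B -> V).
Hypothesis betal : forall b, linear (beta^~ b).
Hypothesis betar : forall a, linear (beta a).

Fixpoint teval (x : tterm k A B) : V :=
  match x with
  | tPure a b => beta a b
  | tAdd y z => teval y + teval z
  | tScale c y => c *: teval y
  end.

Lemma teval_cong x y : cg x y -> teval x = teval y.
Proof.
have b0 : beta 0 0 = 0.
  have := betal 0 1 0 0; rewrite !scale1r addr0.
  by rewrite -[LHS]addr0 => /addrI.
elim=> {x y} //=.
- by move=> x y z _ -> _ ->.
- by move=> x x' y y' _ -> _ ->.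
- by move=> c x x' _ ->.
- by move=> x y z; rewrite addrA.
- by move=> x y; rewrite addrC.
- by move=> x; rewrite b0 add0r.
- by move=> c d x; rewrite scalerA.
- by move=> x; rewrite scale1r.
- by move=> x; rewrite b0 scale0r.
- by move=> c x y; rewrite scalerDr.
- by move=> c d x; rewrite scalerDl.
- by move=> c a a' b; exact: betal.
- by move=> c a b b'; exact: betar.
Qed.

Definition tensor_lift_fun (u : tensor) : V := teval (repr u).

Lemma tensor_lift_pi x : tensor_lift_fun (tensor_pi x) = teval x.
Proof. by apply: teval_cong; exact: tensor_repr. Qed.

Lemma tensor_lift_linear : linear tensor_lift_fun.
Proof.
move=> c u v; rewrite -[u]tensor_reprK -[v]tensor_reprK.
by rewrite -tensor_piZ -tensor_piD !tensor_lift_pi.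
Qed.

HB.instance Definition _ :=
  GRing.isLinear.Build k tensor V _ tensor_lift_fun tensor_lift_linear.

Definition tensor_lift : {linear tensor -> V} := tensor_lift_fun.

Lemma tensor_lift_pure a b : tensor_lift (tpure a b) = beta a b.
Proof. exact: tensor_lift_pi. Qed.

End TensorLift.
End Tensor.

(* A nonzero vector is detected by some linear functional (Zorn).             *)
Lemma exists_functional (k : fieldType) (V : lmodType k) (e : V) : e != 0 ->
  exists phi : {linear V -> k^o}, phi e = 1.
Proof.
move=> e0.
pose P (M : set V) := (forall a x y, M x -> M y -> M (a *: x + y)) /\ ~ M e.
have [F FP Ftot|M [[Mlin Me] Mmax]] := @Zorn_bigcup V P.
  split=> [a x y [X FX Xx] [Y FY Yy]|[X FX Xe]]; last by case: (FP X FX).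
  have [XY|YX] := Ftot X Y FX FY.
    by exists Y => //; apply: (FP Y FY).1 => //; exact: XY.
  by exists X => //; apply: (FP X FX).1 => //; exact: YX.
have M0 : M 0.
  apply: contrapT => nM0.
  have M_empty x : ~ M x.
    by move=> Mx; apply: nM0; have := Mlin (-1) x x Mx Mx; rewrite scaleN1r addNr.
  apply: (Mmax [set 0]%classic).
    by split=> [x /M_empty //|]; move=> /(_ 0 erefl).
  split=> [a x y -> ->|/eqP]; last by rewrite (negbTE e0).
  by rewrite scaler0 addr0.
have MZ a x : M x -> M (a *: x).
  by move=> Mx; rewrite -[_ *: _]addr0; exact: Mlin.
have MD x y : M x -> M y -> M (x + y).
  by move=> Mx My; rewrite -[x]scale1r; exact: Mlin.
have dec v : exists c, M (v - c *: e).
  have [Mv|nMv] := pselect (M v); first by exists 0; rewrite scale0r subr0.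
  pose N : set V := fun u => exists a, M (u - a *: v).
  have [[a Na]|nNe] := pselect (N e).
    have a0 : a != 0.
      by apply: contra_notN Me => /eqP a0; move: Na; rewrite a0 scale0r subr0.
    exists a^-1; have := MZ (- a^-1) _ Na.
    by rewrite scalerBr scalerA !scaleNr mulNr mulVf // scaleN1r opprK addrC.
  case: (Mmax N).
    split=> [u Mu|NM]; first by exists 0; rewrite scale0r subr0.
    by apply: nMv; apply: NM; exists 1; rewrite scale1r subrr.
  split=> // a x y [b Mb] [c Mc]; exists (a * b + c).
  by have := Mlin a _ _ Mb Mc; rewrite scalerBr scalerA addrACA -opprD -scalerDl.
have uniq v c d : M (v - c *: e) -> M (v - d *: e) -> c = d.
  move=> Mc Md; apply/eqP; rewrite -subr_eq0; apply: contrapT => /negP cd.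
  apply: Me; rewrite -[e]scale1r -(mulVf cd) -scalerA; apply: MZ.
  have := Mlin (-1) _ _ Mc Md.
  by rewrite scaleN1r opprB addrA addrNK scalerBl.
pose f (v : V) : k^o := projT1 (cid (dec v)).
have fP v : M (v - f v *: e) := projT2 (cid (dec v)).
have flin : linear f.
  move=> a u v; apply: (uniq (a *: u + v)) (fP _) _.
  have := Mlin a _ _ (fP u) (fP v).
  by rewrite scalerBr scalerA addrACA -opprD -scalerDl.
pose fL := GRing.isLinear.Build k V k^o *:%R f flin.
pose phi : {linear V -> k^o} := HB.pack f fL.
exists phi; apply: (uniq e) (fP e) _.
by rewrite scale1r subrr.
Qed.

Section TensorAlgebra.
Variables (k : fieldType) (A B : algType k).
Local Notation AB := (tensor A B).
Implicit Types u v w : AB.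

Lemma tensor_lmul_subproof1 (a : A) (b : B) d :
  linear (fun c => tpure (a * c) (b * d) : AB).
Proof. by move=> s x y; rewrite mulrDr -scalerAr tpure_linl. Qed.
Lemma tensor_lmul_subproof2 (a : A) (b : B) c :
  linear (fun d => tpure (a * c) (b * d) : AB).
Proof. by move=> s x y; rewrite mulrDr -scalerAr tpure_linr. Qed.

Definition tensor_lmul (a : A) (b : B) : {linear AB -> AB} :=
  tensor_lift (tensor_lmul_subproof1 a b) (tensor_lmul_subproof2 a b).

Lemma tensor_lmulE a b c d :
  tensor_lmul a b (tpure c d) = tpure (a * c) (b * d).
Proof. exact: tensor_lift_pure. Qed.

Lemma tensor_mul_subproof1 v (b : B) : linear (fun a => tensor_lmul a b v).
Proof.
move=> s a a'; elim/tensor_ind: v => [c d|v w IHv IHw].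
  by rewrite !tensor_lmulE mulrDl -scalerAl tpure_linl.
by rewrite !linearD IHv IHw /= addrACA.
Qed.
Lemma tensor_mul_subproof2 v (a : A) : linear (fun b => tensor_lmul a b v).
Proof.
move=> s b b'; elim/tensor_ind: v => [c d|v w IHv IHw].
  by rewrite !tensor_lmulE mulrDl -scalerAl tpure_linr.
by rewrite !linearD IHv IHw /= addrACA.
Qed.

Definition tensor_mul (u v : AB) : AB :=
  tensor_lift (tensor_mul_subproof1 v) (tensor_mul_subproof2 v) u.

Lemma tensor_mulE a b c d :
  tensor_mul (tpure a b) (tpure c d) = tpure (a * c) (b * d).
Proof. by rewrite /tensor_mul tensor_lift_pure tensor_lmulE. Qed.

Lemma tensor_mulDl : left_distributive tensor_mul +%R.
Proof. by move=> u v w; rewrite /tensor_mul linearD. Qed.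
Lemma tensor_mulDr : right_distributive tensor_mul +%R.
Proof.
move=> u v w; elim/tensor_ind: u => [a b|u u' IH IH'].
  by rewrite /tensor_mul !tensor_lift_pure linearD.
by rewrite !tensor_mulDl IH IH' addrACA.
Qed.
Lemma tensor_mulA : associative tensor_mul.
Proof.
move=> u v w; elim/tensor_ind: u => [a b|u u' IH IH']; last first.
  by rewrite !tensor_mulDl IH IH'.
elim/tensor_ind: v => [c d|v v' IH IH']; last first.
  by rewrite !(tensor_mulDl, tensor_mulDr) IH IH'.
elim/tensor_ind: w => [e f|w w' IH IH']; last first.
  by rewrite !tensor_mulDr IH IH'.
by rewrite !tensor_mulE !mulrA.
Qed.
Lemma tensor_mul1l : left_id (tpure 1 1) tensor_mul.
Proof.
move=> u; elim/tensor_ind: u => [a b|u u' IH IH'].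
  by rewrite tensor_mulE !mul1r.
by rewrite tensor_mulDr IH IH'.
Qed.
Lemma tensor_mul1r : right_id (tpure 1 1) tensor_mul.
Proof.
move=> u; elim/tensor_ind: u => [a b|u u' IH IH'].
  by rewrite tensor_mulE !mulr1.
by rewrite tensor_mulDl IH IH'.
Qed.
Lemma tensor_neq0 : tpure 1 1 != 0 :> AB.
Proof.
have [phi phi1] := exists_functional (oner_neq0 A).
have [psi psi1] := exists_functional (oner_neq0 B).
have hl b : linear ((fun a b => phi a * psi b : k^o)^~ b).
  by move=> s a a'; rewrite linearP mulrDl -scalerAl.
have hr a : linear ((fun a b => phi a * psi b : k^o) a).
  by move=> s b b'; rewrite linearP mulrDr -scalerAr.
apply/eqP => /(congr1 (tensor_lift hl hr)).
rewrite tensor_lift_pure linear0 phi1 psi1 mulr1 => /eqP.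
by rewrite oner_eq0.
Qed.

HB.instance Definition _ := GRing.Zmodule_isNzRing.Build (tensor A B)
  tensor_mulA tensor_mul1l tensor_mul1r tensor_mulDl tensor_mulDr tensor_neq0.

Lemma tensor_scaleAl (c : k) u v : c *: (u * v) = (c *: u) * v.
Proof. by rewrite /GRing.mul /= /tensor_mul linearZ. Qed.
HB.instance Definition _ :=
  GRing.Lmodule_isLalgebra.Build k (tensor A B) tensor_scaleAl.
Lemma tensor_scaleAr (c : k) u v : c *: (u * v) = u * (c *: v).
Proof.
elim/tensor_ind: u => [a b|u u' IH IH']; last first.
  by rewrite !mulrDl scalerDr IH IH'.
by rewrite /GRing.mul /= /tensor_mul !tensor_lift_pure linearZ.
Qed.
HB.instance Definition _ :=
  GRing.Lalgebra_isAlgebra.Build k (tensor A B) tensor_scaleAr.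

Lemma tpureM (a c : A) (b d : B) :
  tpure a b * tpure c d = tpure (a * c) (b * d) :> tensor A B.
Proof. exact: tensor_mulE. Qed.

End TensorAlgebra.

Section Orbit.
Variables (k : fieldType) (n : nat).

Definition orbit_alg : algType k := tensor (weyl k) (uea (gquot k n)).

(* The image of v_i in T_n.                                                   *)
Definition Tv (i : nat) : orbit_alg := tpure 1 (uea_inj (gv k n i)).

(* The image in T_n of f in k[t], viewed in A_1.                              *)
Definition Tpoly (f : {poly k}) : orbit_alg :=
  tpure (horner_alg (weyl_t k) f) 1.

Definition Td : orbit_alg := tpure (weyl_d k) 1.

Definition dpder (m : nat) (f : {poly k}) : {poly k} :=
  m`!%:R^-1 *: f^`(m).

Definition orbit_fun (f : witt k) : orbit_alg :=
  Tpoly f * Td + \sum_(i < n) Tpoly (dpder i.+1 f) * Tv i.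

Lemma TpolyM f g : Tpoly (f * g) = Tpoly f * Tpoly g.
Proof. by rewrite /Tpoly tpureM rmorphM mulr1. Qed.
Lemma Tpoly_linear : linear Tpoly.
Proof. by move=> a f g; rewrite /Tpoly linearP /= mulr_algl tpure_linl. Qed.
HB.instance Definition _ :=
  GRing.isLinear.Build k {poly k} orbit_alg _ Tpoly Tpoly_linear.

Lemma Tpoly_Tv f i : Tv i * Tpoly f = Tpoly f * Tv i.
Proof. by rewrite /Tpoly /Tv !tpureM !mulr1 !mul1r. Qed.

Lemma Td_Tv i : Tv i * Td = Td * Tv i.
Proof. by rewrite /Td /Tv !tpureM !mulr1 !mul1r. Qed.

Lemma weyl_d_poly f :
  weyl_d k * horner_alg (weyl_t k) f =
  horner_alg (weyl_t k) f * weyl_d k + horner_alg (weyl_t k) f^`().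
Proof.
have dt : weyl_d k * weyl_t k = 1 + weyl_t k * weyl_d k.
  by rewrite -(weyl_dt k) subrK.
elim/poly_ind: f => [|p c IH]; first by rewrite derivC !rmorph0 mulr0 mul0r addr0.
rewrite derivD derivM derivX derivC addr0 mulr1.
rewrite !rmorphD !rmorphM /= horner_algX horner_algC.
rewrite mulrDr mulrA IH !mulrDl -!mulrA dt mulrDr mulr1 -scalerAl -scalerAr.
rewrite mul1r mulr1 -!addrA addrC -!addrA; congr (_ + _).
by rewrite addrCA.
Qed.

Lemma Td_Tpoly f : Td * Tpoly f = Tpoly f * Td + Tpoly f^`().
Proof. by rewrite /Td /Tpoly !tpureM !mulr1 weyl_d_poly tpureDl. Qed.

Lemma Tv_lie i j :
  Tv i * Tv j - Tv j * Tv i = (j%:R - i%:R) *: Tv (i + j).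
Proof.
have -> : (j%:R - i%:R) *: Tv (i + j) = tpure 1 (uea_inj (lie (gv k n i) (gv k n j))).
  by rewrite gv_lie linearZ tpureZr.
rewrite /Tv !tpureM !mulr1 uea_inj_lie.
by rewrite tpureDr -scaleN1r -tpureZr scaleN1r.
Qed.

Lemma Tv_eq0 i : (n <= i)%N -> Tv i = 0.
Proof. by move=> hi; rewrite /Tv gv_eq0 // linear0 tpure0r. Qed.

Definition commr (x y : orbit_alg) : orbit_alg := x * y - y * x.

Lemma commrDl x y z : commr (x + y) z = commr x z + commr y z.
Proof. by rewrite /commr mulrDl mulrDr opprD addrACA. Qed.
Lemma commrN x y : commr x y = - commr y x.
Proof. by rewrite /commr opprB. Qed.
Lemma commrDr x y z : commr x (y + z) = commr x y + commr x z.
Proof. by rewrite commrN commrDl opprD -!commrN. Qed.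
Lemma commr_suml (F : 'I_n -> orbit_alg) y :
  commr (\sum_i F i) y = \sum_i commr (F i) y.
Proof. by rewrite /commr mulr_suml mulr_sumr -sumrB. Qed.
Lemma commr_sumr (F : 'I_n -> orbit_alg) y :
  commr y (\sum_i F i) = \sum_i commr y (F i).
Proof. by rewrite /commr mulr_suml mulr_sumr -sumrB. Qed.

Lemma commrDD a b c d :
  commr (a + b) (c + d) = commr a c + (commr a d - commr c b + commr b d).
Proof.
rewrite commrDl !commrDr [commr b c]commrN.
by move: (commr _ _) (commr _ _) (commr _ _) (commr _ _) => *; rewrite !addrA.
Qed.

Lemma TpolyC f g : Tpoly f * Tpoly g = Tpoly g * Tpoly f.
Proof. by rewrite -!TpolyM mulrC. Qed.

Lemma commr_dd f g :
  commr (Tpoly f * Td) (Tpoly g * Td) = Tpoly (f * g^`() - f^`() * g) * Td.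
Proof.
rewrite /commr -!mulrA ![Td * (Tpoly _ * _)]mulrA !Td_Tpoly !mulrDl !mulrDr.
rewrite !mulrA -!TpolyM [g * f]mulrC [g * _]mulrC opprD addrACA subrr add0r.
by rewrite raddfB /= mulrBl.
Qed.

Lemma commr_dv f g j :
  commr (Tpoly f * Td) (Tpoly g * Tv j) = Tpoly (f * g^`()) * Tv j.
Proof.
rewrite /commr; set x := _ * _ * (_ * _).
have -> : x = Tpoly (f * g) * Td * Tv j + Tpoly (f * g^`()) * Tv j.
  by rewrite /x !mulrA -[_ * Td * _]mulrA Td_Tpoly mulrDr mulrDl !mulrA -!TpolyM.
rewrite -[Tpoly g * _ * _]mulrA [Tv j * _]mulrA Tpoly_Tv -[_ * Tv j * _]mulrA.
by rewrite Td_Tv !mulrA -TpolyM [g * f]mulrC addrC addKr.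
Qed.

Lemma commr_vv f g i j :
  commr (Tpoly f * Tv i) (Tpoly g * Tv j) =
  Tpoly ((j%:R - i%:R) *: (f * g)) * Tv (i + j).
Proof.
have h f' g' i' j' :
    Tpoly f' * Tv i' * (Tpoly g' * Tv j') = Tpoly (f' * g') * (Tv i' * Tv j').
  by rewrite !mulrA -[_ * Tv i' * _]mulrA Tpoly_Tv mulrA -TpolyM.
rewrite /commr !h [g * f]mulrC -mulrBr Tv_lie [Tpoly (_ *: _)]linearZ.
by rewrite -scalerAr -scalerAl.
Qed.

Hypothesis char0 : [pchar k] =i pred0.

Lemma char0_nat_neq0 m : m.+1%:R != 0 :> k.
Proof. by move/pcharf0P: char0 => ->. Qed.

Lemma deriv_dpder m f : (dpder m f)^`() = m.+1%:R *: dpder m.+1 f.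
Proof.
rewrite /dpder derivZ -derivnS scalerA factS natrM invfM mulrA divff ?mul1r //.
exact: char0_nat_neq0.
Qed.

Lemma dpder_linear m : linear (dpder m).
Proof.
move=> a f g; rewrite /dpder derivnD derivnZ scalerDr !scalerA.
by rewrite [a * _]mulrC.
Qed.

Lemma dpder0 f : dpder 0 f = f.
Proof. by rewrite /dpder fact0 invr1 scale1r. Qed.
Lemma dpder1 f : dpder 1 f = f^`().
Proof. by rewrite /dpder factS fact0 invr1 scale1r. Qed.

Lemma scaleZM2 (a b c : k) (F G H J : {poly k}) :
  a *: (b *: F * G + H * (c *: J)) = (a * b) *: (F * G) + (a * c) *: (H * J).
Proof. by rewrite scalerDr -scalerAl -scalerAr !scalerA. Qed.

Lemma dpder_lie f g m :
  dpder m (f * g^`() - f^`() * g) =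
  \sum_(p < m.+2) (m.+1%:R - p%:R *+ 2) *:
     (dpder p f * dpder (m.+1 - p) g).
Proof.
elim: m => [|m IH].
  rewrite !big_ord_recl big_ord0 /= /bump /= add1n subn0 subnn.
  rewrite !dpder0 !dpder1 addr0 mul0rn subr0 scale1r.
  by rewrite mulr2n opprD addrA subrr sub0r scaleN1r.
apply: (scalerI (char0_nat_neq0 m)); rewrite -deriv_dpder IH raddf_sum /=.
pose T (p : nat) := dpder p f * dpder (m.+2 - p) g.
pose a (p : nat) : k := (m.+1%:R - p%:R *+ 2).
transitivity (\sum_(p < m.+2) (a p * p.+1%:R) *: T p.+1 +
              \sum_(p < m.+2) (a p * (m.+2 - p)%:R) *: T p).
  rewrite -big_split /=; apply: eq_bigr => -[p hp] _ /=.
  by rewrite derivZ derivM !deriv_dpder scaleZM2 /T subSS -subSn.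
have -> : \sum_(p < m.+2) (a p * (m.+2 - p)%:R) *: T p =
          \sum_(p < m.+3) (a p * (m.+2 - p)%:R) *: T p.
  by rewrite [RHS]big_ord_recr /= subnn mulr0 scale0r addr0.
pose b (p : nat) : k := (m.+3%:R - p%:R *+ 2) * p%:R.
have -> : \sum_(p < m.+2) (a p * p.+1%:R) *: T p.+1 =
          \sum_(p < m.+3) b p *: T p.
  rewrite [RHS]big_ord_recl /= /b mulr0 scale0r add0r.
  apply: eq_bigr => p _; rewrite /bump /= add1n; congr (_ *: _).
  by rewrite /a -[m.+3]addn2 -[p.+1]addn1 !natrD; ring.
rewrite -big_split scaler_sumr; apply: eq_bigr => -[p hp] _ /=.
rewrite -scalerDl scalerA; congr (_ *: _).
rewrite natrB // /a /b -[m.+3]addn3 -[m.+2]addn2 -[m.+1]addn1 !natrD.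
by ring.
Qed.

Lemma dpder_lieS f g (m : nat) : (m < n)%N ->
  dpder m.+1 (f * g^`() - f^`() * g) =
  f * (dpder m.+1 g)^`() - g * (dpder m.+1 f)^`() +
  \sum_(i < n) \sum_(j < n)
     (if (i + j == m)%N then
        (j%:R - i%:R) *: (dpder i.+1 f * dpder j.+1 g) else 0).
Proof.
move=> hm; rewrite dpder_lie big_ord_recl big_ord_recr /= !deriv_dpder.
rewrite /bump /= add1n subnn subn0 mul0rn subr0.
rewrite !dpder0; move: (dpder m.+2 f) (dpder m.+2 g) => F G.
have -> : m.+2%:R - m.+2%:R *+ 2 = - m.+2%:R :> k.
  by rewrite mulr2n opprD addrA subrr sub0r.
rewrite -!scalerAr [g * F]mulrC scaleNr addrA addrAC; congr (_ + _).
transitivity (\sum_(i < n) if (i < m.+1)%N then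
   (m%:R - i%:R *+ 2) *: (dpder i.+1 f * dpder (m - i).+1 g) else 0).
  rewrite -big_mkcond /= -(big_ord_widen n (fun i =>
    (m%:R - i%:R *+ 2) *: (dpder i.+1 f * dpder (m - i).+1 g))) //.
  apply: eq_bigr => -[i hi] _ /=; rewrite add1n subSS subSn //.
  congr (_ *: _); rewrite -[m.+2]addn2 -[i.+1]addn1 !natrD; ring.
apply: eq_bigr => -[i hi] _ /=; case: ltnP => him.
  have hj : (m - i < n)%N by apply: leq_ltn_trans (leq_subr _ _) hm.
  rewrite (bigD1 (Ordinal hj)) //= subnKC // eqxx big1 ?addr0.
    by rewrite natrB // mulr2n opprD addrA.
  move=> j hjj; case: eqP => // e; case/eqP: hjj; apply: val_inj => /=.
  by rewrite -e addKn.
rewrite big1 // => j _; case: eqP => // e.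
by move: him; rewrite -e ltnNge leq_addr.
Qed.

Lemma orbit_fun_linear : linear orbit_fun.
Proof.
move=> a f g; rewrite /orbit_fun [Tpoly (a *: f + g)]linearP mulrDl -scalerAl.
rewrite scalerDr addrACA; congr (_ + _).
rewrite scaler_sumr -big_split; apply: eq_bigr => i _ /=.
by rewrite [dpder _ _]dpder_linear linearP mulrDl -scalerAl.
Qed.

Lemma orbit_fun_lie f g :
  orbit_fun (lie f g) =
  orbit_fun f * orbit_fun g - orbit_fun g * orbit_fun f.
Proof.
rewrite -[RHS]/(commr _ _) /orbit_fun -[lie f g]/(witt_lie f g) /witt_lie.
rewrite commrDD commr_dd; congr (_ + _).
rewrite commr_suml; under [X in _ = _ + X]eq_bigr do rewrite commr_sumr.
rewrite !commr_sumr -sumrN.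
under [LHS]eq_bigr do rewrite dpder_lieS //.
have -> : \sum_(i < n) \sum_(j < n)
    commr (Tpoly (dpder i.+1 f) * Tv i) (Tpoly (dpder j.+1 g) * Tv j) =
  \sum_(m < n) Tpoly (\sum_(i < n) \sum_(j < n)
     (if (i + j == m)%N then
        (j%:R - i%:R) *: (dpder i.+1 f * dpder j.+1 g) else 0)) * Tv m.
  transitivity (\sum_(i < n) \sum_(j < n) \sum_(m < n)
     Tpoly (if (i + j == m)%N then
        (j%:R - i%:R) *: (dpder i.+1 f * dpder j.+1 g) else 0) * Tv m).
    apply: eq_bigr => i _; apply: eq_bigr => j _; rewrite commr_vv.
    have [hn|hn] := ltnP (i + j) n.
      rewrite (bigD1 (Ordinal hn)) //= eqxx big1 ?addr0 // => m hm.
      case: eqP => [e|_]; last by rewrite raddf0 mul0r.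
      by case/eqP: hm; apply: val_inj.
    rewrite Tv_eq0 // mulr0 big1 // => m _.
    case: eqP => [e|_]; last by rewrite raddf0 mul0r.
    by have := ltn_ord m; rewrite -e ltnNge hn.
  under eq_bigr do rewrite exchange_big /=.
  rewrite exchange_big /=; apply: eq_bigr => m _.
  rewrite raddf_sum mulr_suml; apply: eq_bigr => i _.
  by rewrite raddf_sum mulr_suml.
rewrite -!big_split; apply: eq_bigr => m _ /=.
rewrite !commr_dv raddfD raddfB /= !mulrDl mulNr.
by rewrite -addrA.
Qed.

Definition orbit_hom : {lrmorphism uea (witt k) -> orbit_alg} :=
  uea_lift orbit_fun_linear orbit_fun_lie.

Lemma orbit_homE f : orbit_hom (uea_inj f) = orbit_fun f.
Proof. exact: uea_lift_inj. Qed.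

End Orbit.

Local Open Scope classical_set_scope.

(* Ideals of a subring S of R; I is a subset of R contained in S.             *)
Section SubringIdeals.
Variable R : nzRingType.
Implicit Types S I : set R.

Definition left_ideal S I : Prop :=
  [/\ I `<=` S, I 0, forall x y, I x -> I y -> I (x - y)
    & forall s x, S s -> I x -> I (s * x)].

Definition right_ideal S I : Prop :=
  [/\ I `<=` S, I 0, forall x y, I x -> I y -> I (x - y)
    & forall s x, S s -> I x -> I (x * s)].

Definition two_sided_ideal S I : Prop := left_ideal S I /\ right_ideal S I.

(* The membership conditions on generators matter: smallest C G is the full   *)
(* set when no member of C contains G.                                        *)
Definition generates_two_sided S I (g : R) : Prop :=
  S g /\ I = smallest (two_sided_ideal S) [set g].

Definition fg_left_ideal S I : Prop :=
  exists s : seq R,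
    [set` s] `<=` S /\ I = smallest (left_ideal S) [set` s].

Definition fg_right_ideal S I : Prop :=
  exists s : seq R,
    [set` s] `<=` S /\ I = smallest (right_ideal S) [set` s].

End SubringIdeals.

Definition orbit_image (k : fieldType) (n : nat) (char0 : [pchar k] =i pred0) :
    set (orbit_alg k n) :=
  range (orbit_hom n char0).
Arguments orbit_image {k} n char0.

(* Main.v *)
From HB Require Import structures.
Require Import Defs.
From mathcomp Require Import all_boot all_order all_algebra.
From mathcomp Require Import boolp classical_sets.
From mathcomp Require Import ring.
Import GRing.Theory.
Local Open Scope classical_set_scope.
Local Open Scope ring_scope.

Set Implicit Arguments.
Unset Strict Implicit.
Unset Printing Implicit Defensive.

(** Write e(f) for the image of f d/dt in T_n, D_p for the divided power of the
    p-th derivative, v for v_(n-1), and v_(-1) for d/dt, so that e(f) is the sum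
    of the D_p(f) v_(p-1) for 0 <= p <= n.  Let I = T_n v^2.

    The image B_n contains I.  Up to terms f D_(q+1)(g) v_(q-1), which come from
    moving d/dt past a polynomial, e(f) e(g) is the sum of the
    D_p(f) D_q(g) v_(p-1) v_(q-1).  Replacing a bilinear expression F(f, g) by
    F(f, t g) - F(t f, g) keeps its values in B_n, and by the Leibniz rule it
    lowers the order p + q of D_p(f) D_q(g) by one.  After 2n steps every term of
    order less than 2n is gone, which includes the extra terms because
    n + 1 < 2n; only a nonzero multiple of f g v^2 is left
    [iter_antidiff_orbit_fun].  Hence B_n contains k[t] v^2.  The highest term of
    e(t^p) is v_(p-1) with coefficient 1, so left multiplication by the e(f)
    produces from k[t] v^2 all of T_n v^2 [orbit_fun_fill].

    The ideal I is principal in B_n.  Since v^2 commutes with t, d/dt and the v_i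
    with i > 0, and [v_0, v^2] = 2 (n - 1) v^2, the commutator of e(f) and v^2 is
    2 (n - 1) f' v^2.  A two-sided ideal of B_n that contains v^2 therefore
    contains k[t] v^2, and then I by [orbit_fun_fill].

    The ideal I is not finitely generated on either side.  It suffices to find
    linear functionals eta_m on T_n, for all natural m, which kill I e(f) for
    every f (right ideals) or e(f) I (left ideals) and which separate the
    multiples of the t^j v^2: as B_n is spanned by the products of the e(f), the
    space of sequences (eta_m(x))_m with x in I would be finite-dimensional if I
    had finitely many generators [not_finitely_generated].  The eta_m are tensor
    products of functionals on the two factors.
    On A_1 they are matrix coefficients of k[t], where d/dt kills 1, or of its
    Fourier transform, where t acts by - d/dt and d/dt by multiplication by t, so
    that the constant term kills the image of d/dt.  On U(g_n) one needs a
    functional that does not kill v^2 and for which each v_i, put next to v^2,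
    acts by a scalar that vanishes for i > 0 and is prescribed for i = 0
    [top_sq_functional].  It comes from the tensor square of the action of g_n on
    t k[t] / t^(n+1), twisted by a multiple of the trace: there v acts on the
    untwisted module by a matrix E of rank one and square zero, so v^2 acts on
    the tensor square by 2 E (x) E, and the products of E with the v_i are
    multiples of E.

    In the lemmas the index is shifted: g_(n+1) has the top element v_n, and
    n > 0. *)

(** * Presented algebras: induction and actions *)

Lemma palg_ind (k : fieldType) (P : presentation k) (Q : palg P -> Prop) :
  (forall c, Q c%:A) -> (forall g, Q (palg_gen g)) ->
  (forall u v, Q u -> Q v -> Q (u + v)) ->
  (forall u v, Q u -> Q v -> Q (u * v)) -> forall u, Q u.
Proof.
move=> Qc Qg QD QM u; rewrite -[u]palg_reprK.
elim: (repr u) => [g|c|x IHx y IHy|x IHx y IHy].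
- exact: Qg.
- by rewrite palg_piC; exact: Qc.
- by rewrite palg_piD; exact: QD.
- by rewrite palg_piM; exact: QM.
Qed.

Section PresentedAction.
Variables (k : fieldType) (P : presentation k) (V : lmodType k).
Variable rho : pgen P -> V -> V.
Hypothesis rho_lin : forall g, linear (rho g).
Hypothesis rho_rel : forall x y, prel x y -> aact rho x =1 aact rho y.

Definition palg_act (u : palg P) (v : V) : V := aact rho (repr u) v.

Lemma palg_act_pi x v : palg_act (palg_pi x) v = aact rho x v.
Proof. exact: (aact_cong rho_lin rho_rel (palg_repr x)). Qed.

Lemma palg_act_gen g v : palg_act (palg_gen g) v = rho g v.
Proof. exact: palg_act_pi. Qed.

Lemma palg_act_linl v : linear (palg_act^~ v).
Proof.
move=> c x y; rewrite -[x]palg_reprK -[y]palg_reprK -palg_piZ -palg_piD.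
by rewrite !palg_act_pi.
Qed.

Lemma palg_actM x y v : palg_act (x * y) v = palg_act x (palg_act y v).
Proof.
by rewrite -[x]palg_reprK -[y]palg_reprK -palg_piM !palg_act_pi.
Qed.

Lemma palg_act1 v : palg_act 1 v = v.
Proof. by rewrite -[1]/(palg_pi (aCst 1)) palg_act_pi /= scale1r. Qed.

Lemma palg_act0 x : palg_act x 0 = 0.
Proof. exact: aact0. Qed.

End PresentedAction.

(** * Two modules over the Weyl algebra *)

Section WeylModules.
Variable k : fieldType.
Let WP := Presentation (@weyl_pres_neq0 k).

Lemma weyl_act_lin g : linear (@weyl_act k g).
Proof.
by case: g => a p q /=; [rewrite mulrDr -scalerAr|rewrite derivD derivZ].
Qed.

Lemma weyl_act_rel x y :
  @weyl_rel k x y -> aact (@weyl_act k) x =1 aact (@weyl_act k) y.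
Proof. by case=> p /=; rewrite derivM derivX mul1r scale1r addrC. Qed.

Definition poly_act : weyl k -> {poly k} -> {poly k} :=
  @palg_act k WP {poly k} (@weyl_act k).

(** The Fourier transform of k[t].  Unlike in k[t], the operator d/dt is not
    surjective here, so some functional (the constant term) kills its image. *)
Definition fourier_gen (g : weyl_gen) (p : {poly k}) : {poly k} :=
  match g with weyl_gt => - p^`() | weyl_gd => 'X * p end.

Lemma fourier_lin g : linear (fourier_gen g).
Proof.
case: g => a p q /=; last by rewrite mulrDr -scalerAr.
by rewrite derivD derivZ opprD scalerN.
Qed.

Lemma fourier_rel x y :
  @weyl_rel k x y -> aact fourier_gen x =1 aact fourier_gen y.
Proof.
case=> p /=; rewrite derivM derivX mul1r scale1r opprD mulrN.
by rewrite [RHS]addrC addrA subrr add0r.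
Qed.

Definition fourier_act : weyl k -> {poly k} -> {poly k} :=
  @palg_act k WP {poly k} fourier_gen.

Lemma poly_actM a b p : poly_act (a * b) p = poly_act a (poly_act b p).
Proof. exact: @palg_actM k WP _ _ weyl_act_lin weyl_act_rel _ _ _. Qed.

Lemma poly_act_linl p : linear (poly_act^~ p).
Proof. exact: @palg_act_linl k WP _ _ weyl_act_lin weyl_act_rel _. Qed.

(** The vector 1 is killed by d/dt; this makes the coefficients of a . 1 blind to
    A_1 d/dt. *)
Lemma poly_act_d1 a : poly_act (a * weyl_d k) 1 = 0.
Proof.
rewrite poly_actM.
rewrite [X in poly_act a X](@palg_act_gen k WP _ _ weyl_act_lin weyl_act_rel).
by rewrite /= derivC; exact: (@palg_act0 k WP _ _ weyl_act_lin).
Qed.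

Lemma poly_act_tX j : poly_act (weyl_t k ^+ j) 1 = 'X^j.
Proof.
elim: j => [|j IH]; first exact: @palg_act1 k WP _ _ weyl_act_lin weyl_act_rel _.
rewrite exprS poly_actM IH.
by rewrite [LHS](@palg_act_gen k WP _ _ weyl_act_lin weyl_act_rel) /= -exprS.
Qed.

Lemma fourier_actM a b p :
  fourier_act (a * b) p = fourier_act a (fourier_act b p).
Proof. exact: @palg_actM k WP _ _ fourier_lin fourier_rel _ _ _. Qed.

Lemma fourier_act_linl p : linear (fourier_act^~ p).
Proof. exact: @palg_act_linl k WP _ _ fourier_lin fourier_rel _. Qed.

Lemma fourier_act_d0 a p : (fourier_act (weyl_d k * a) p)`_0 = 0.
Proof.
have act_d q : fourier_act (weyl_d k) q = 'X * q.
  exact: (@palg_act_gen k WP _ _ fourier_lin fourier_rel).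
by rewrite fourier_actM act_d coefXM.
Qed.

Lemma fourier_act_tX j p : fourier_act (weyl_t k ^+ j) p = (-1) ^+ j *: p^`(j).
Proof.
elim: j => [|j IH].
  by rewrite scale1r; exact: @palg_act1 k WP _ _ fourier_lin fourier_rel _.
rewrite exprS fourier_actM IH.
rewrite [LHS](@palg_act_gen k WP _ _ fourier_lin fourier_rel) /= derivZ -derivnS.
by rewrite exprS mulN1r scaleNr.
Qed.

Lemma fourier_act_tX_Xn j m :
  (fourier_act (weyl_t k ^+ j) 'X^m)`_0 = (m == j)%:R * ((-1) ^+ j * j`!%:R).
Proof.
rewrite fourier_act_tX coefZ coef_derivn coefXn addn0 ffactnn [j == m]eq_sym.
by case: (m == j); rewrite /= ?mul0rn ?mulr0 ?mul0r // mul1r.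
Qed.

End WeylModules.

(** * The action of the truncated Witt algebra on jets *)

Section JetRepresentation.
Variables (k : fieldType) (n : nat).

(** The matrix of f d/dt on t k[t] / t^(n+2) in the basis t, ..., t^(n+1): column j
    lists the coefficients of f (t^(j+1))'. *)
Definition jet_mx (f : {poly k}) : 'M[k]_n.+1 :=
  \matrix_(i, j) (f * ('X^(j.+1))^`())`_i.+1.

Lemma jet_mxE f i j :
  jet_mx f i j = (if (j <= i.+1)%N then f`_(i.+1 - j) else 0) *+ j.+1.
Proof.
rewrite mxE derivXn /= mulrnAr coefMn coefMXn ltnNge.
by case: (j <= i.+1)%N.
Qed.

Lemma jet_mx_linear : linear jet_mx.
Proof.
by move=> a f g; apply/matrixP => i j; rewrite !mxE mulrDl -scalerAl coefD coefZ.
Qed.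
HB.instance Definition _ :=
  GRing.isLinear.Build k {poly k} 'M[k]_n.+1 _ jet_mx jet_mx_linear.

(** A matrix entry only sees a truncation of p; nothing is lost because the constant
    term of p dies in p' and f has no constant term. *)
Lemma jet_mx_coef (f p : {poly k}) (i : 'I_n.+1) : f`_0 = 0 ->
  \sum_j jet_mx f i j * p`_j.+1 = (f * p^`())`_i.+1.
Proof.
move=> f0; rewrite coefMr [RHS]big_ord_recr /= subnn f0 mul0r addr0.
rewrite (big_ord_widen n.+1 (fun j => f`_(i.+1 - j) * p^`()`_j)) //.
rewrite [RHS]big_mkcond /=; apply: eq_bigr => j _.
rewrite jet_mxE coef_deriv leq_eqVlt ltnS.
case: ltngtP => [ji|ij|->].
- by rewrite orbT mulrnAl mulrnAr.
- case: eqP => [->|_]; last by rewrite mul0rn mul0r.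
  by rewrite subnn f0 mul0rn mul0r.
- by rewrite orbT mulrnAl mulrnAr.
Qed.

Lemma jet_mx_lie (f g : {poly k}) : f`_0 = 0 -> g`_0 = 0 ->
  jet_mx (witt_lie f g) = jet_mx f *m jet_mx g - jet_mx g *m jet_mx f.
Proof.
move=> f0 g0; apply/matrixP => i j; rewrite !mxE.
have e (h h' : {poly k}) : h`_0 = 0 -> \sum_m jet_mx h i m * jet_mx h' m j =
    (h * (h' * ('X^(j.+1))^`())^`())`_i.+1.
  move=> h0; rewrite -jet_mx_coef //; apply: eq_bigr => m _.
  by rewrite [jet_mx h' _ _]mxE.
rewrite !e // -coefB; congr (nth _ (polyseq _) _); move: (('X^(j.+1))^`()) => p.
by rewrite /witt_lie !derivM; ring.
Qed.

(** Multiples of t^(n+2) d/dt act by zero, so the representation descends to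
    [gquot]. *)
Lemma jet_mx_eq0 f : 'X^(n.+2) %| f -> jet_mx f = 0.
Proof.
move=> /dvdpP[q ->]; apply/matrixP => i j.
rewrite jet_mxE mxE; case: ifP => _; rewrite ?mul0rn // coefMXn.
by rewrite (leq_ltn_trans (leq_subr _ _)) ?mul0rn // !ltnS -ltnS.
Qed.

Definition jet_rep (u : gquot k n.+1) : 'M[k]_n.+1 :=
  jet_mx (val (repr u)).

Lemma jet_rep_gpi f : jet_rep (gpi n.+1 f) = jet_mx (val f).
Proof.
apply/eqP; rewrite -subr_eq0 /jet_rep -raddfB; apply/eqP/jet_mx_eq0.
by have := gpi_repr n.+1 f; rewrite unfold_in unfold_in.
Qed.

Lemma jet_rep_linear : linear jet_rep.
Proof.
move=> a u v; rewrite -[u]gpi_reprK -[v]gpi_reprK -gpiZ -gpiD !jet_rep_gpi.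
exact: jet_mx_linear.
Qed.

Lemma jet_rep_lie u v :
  jet_rep (lie u v) = jet_rep u *m jet_rep v - jet_rep v *m jet_rep u.
Proof.
have c0 (f : wittge0 k) : (val f : {poly k})`_0 = 0.
  case: f => f /= hf; move: hf; rewrite unfold_in expr1 => /dvdpP[q ->].
  by rewrite coefMX.
rewrite -[u]gpi_reprK -[v]gpi_reprK -[lie _ _]/(glie _ _) glieE !jet_rep_gpi.
exact: jet_mx_lie.
Qed.

Lemma jet_rep_gv m i j :
  jet_rep (gv k n.+1 m) i j = (i == (j + m)%N :> nat)%:R *+ j.+1.
Proof.
rewrite jet_rep_gpi jet_mxE /= coefXn; congr (_ *+ _).
case: leqP => ji.
  by rewrite -(eqn_add2l j) subnKC // addnS eqSS.
by case: eqP => // e; move: (ltnW ji); rewrite e ltnNge leq_addr.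
Qed.

End JetRepresentation.

(** * The twisted tensor square of the jet representation *)

Section JetTensorSquare.
Variables (k : fieldType) (n : nat).
Hypothesis n_gt0 : (0 < n)%N.

Local Notation M := 'M[k]_n.+1.
Definition jet_alg : algType k := tensor M M.
Local Notation E := jet_alg.

Local Notation jet i := (jet_rep (gv k n.+1 i)).
Definition corner_mx : M := delta_mx ord_max ord0.

Lemma jet_top : jet n = corner_mx.
Proof.
apply/matrixP => i j; rewrite jet_rep_gv mxE -!val_eqE /=.
have [->|j0] := eqVneq (val j) 0%N; first by rewrite add0n andbT.
rewrite andbF; case: eqP => [e|_]; last by rewrite mul0rn.
by have := ltn_ord i; rewrite e ltnS leqNgt -{1}[n]add0n ltn_add2r lt0n j0.
Qed.

Lemma jet_corner_mx i : jet i *m corner_mx = (n.+1 * (i == 0%N))%:R *: corner_mx.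
Proof.
apply/matrixP => a b; rewrite !mxE (bigD1 ord_max) //= big1 => [|j jn].
  rewrite addr0 jet_rep_gv mxE eqxx /= -!val_eqE /=.
  case: i => [|i]; first by rewrite addn0 muln1 -mulr_natl -mulrA -natrM mulnb.
  rewrite muln0 mul0r; case: eqP => [e|_]; last by rewrite mul0rn mul0r.
  by have := ltn_ord a; rewrite e ltnS addnS -ltn_subRL subnn.
by rewrite [corner_mx _ _]mxE (negbTE jn) mulr0.
Qed.

Lemma corner_mx_jet i : corner_mx *m jet i = (i == 0%N)%:R *: corner_mx.
Proof.
apply/matrixP => a b; rewrite !mxE (bigD1 ord0) //= big1 => [|j jn].
  rewrite addr0 jet_rep_gv mxE eqxx andbT.
  rewrite -[b == ord0]val_eqE /= [0%N == (_ + _)%N]eq_sym addn_eq0.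
  case: i => [|i]; last by rewrite andbF mul0rn mulr0 mul0r.
  rewrite andbT mul1r; case: (val b =P 0%N) => [->|_].
    by rewrite andbT mulr1.
  by rewrite andbF mul0rn mulr0.
by rewrite [corner_mx _ _]mxE (negbTE jn) andbF mul0r.
Qed.

Lemma corner_mx_sq : corner_mx *m corner_mx = 0.
Proof.
rewrite /corner_mx mul_delta_mx_0 //; apply/eqP => /(congr1 val) /= e.
by move: n_gt0; rewrite -e.
Qed.

Lemma trace_jet i : \tr (jet i) = (i == 0%N)%:R * 'C(n.+2, 2)%:R.
Proof.
rewrite /mxtrace; under eq_bigr => j _ do rewrite jet_rep_gv.
case: i => [|i]; last first.
  rewrite mul0r big1 // => j _.
  by rewrite -{1}[val j]addn0 eqn_add2l mul0rn.
rewrite mul1r -bin2_sum big_mkord [RHS]natr_sum [RHS]big_ord_recl add0r.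
by apply: eq_bigr => j _; rewrite addn0 eqxx.
Qed.

Lemma mul_add_scalar (A : algType k) (x y : A) s t :
  (x + s%:A) * (y + t%:A) = x * y + (t *: x + s *: y + (s * t)%:A).
Proof.
rewrite mulrDl !mulrDr -!(scalerAl, scalerAr) !mulr1 !mul1r scalerA.
by rewrite -!addrA.
Qed.

(** The action of a Lie algebra element on a tensor square. *)
Definition coprimitive (a : M) : E := tpure a 1 + tpure 1 a.

Lemma coprimitive_linear : linear coprimitive.
Proof.
by move=> c' a b; rewrite /coprimitive tpure_linl tpure_linr scalerDr addrACA.
Qed.
HB.instance Definition _ :=
  GRing.isLinear.Build k M E _ coprimitive coprimitive_linear.

Lemma coprimitiveM a b : coprimitive a * coprimitive b =
  coprimitive (a * b) + (tpure a b + tpure b a).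
Proof.
rewrite /coprimitive mulrDl !mulrDr !tpureM !mulr1 !mul1r.
by rewrite [tpure b a + _]addrC addrACA.
Qed.

Lemma coprimitive_lie a b :
  coprimitive (a * b - b * a) =
  coprimitive a * coprimitive b - coprimitive b * coprimitive a.
Proof.
rewrite linearB /= !coprimitiveM [tpure b a + _]addrC.
move: (_ + tpure b a) (coprimitive _) (coprimitive _) => w x y.
by rewrite opprD addrACA subrr addr0.
Qed.

Definition corner_tensor : jet_alg := tpure corner_mx corner_mx.

Section Twist.
Variable mu : k.

(** The trace is a character of the Lie algebra, so adding a multiple of it to the
    tensor square gives again a representation; mu adjusts the scalar by which v_0
    acts. *)
Definition jet2 (u : gquot k n.+1) : E :=
  coprimitive (jet_rep u) + (mu * \tr (jet_rep u))%:A.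

Lemma jet2_linear : linear jet2.
Proof.
move=> a u v; rewrite /jet2 jet_rep_linear !linearP /=.
move: (coprimitive _) (coprimitive _) (\tr _) (\tr _) => y x s t.
have -> : mu * (a * t + s) = a * (mu * t) + mu * s by ring.
by rewrite scalerDl -(scalerA a) scalerDr addrACA.
Qed.

Lemma jet2_lie u v : jet2 (lie u v) = jet2 u * jet2 v - jet2 v * jet2 u.
Proof.
have tr0 : \tr (jet_rep (lie u v)) = 0.
  by rewrite jet_rep_lie linearB /= mxtrace_mulC subrr.
rewrite /jet2 tr0 mulr0 scale0r addr0 jet_rep_lie.
rewrite coprimitive_lie !mul_add_scalar.
move: (coprimitive _) (coprimitive _) (mu * _) (mu * _) => x y s t.
by rewrite [s * t]mulrC [t *: y + _]addrC opprD addrACA subrr addr0.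
Qed.

Definition jet2_hom : {lrmorphism uea (gquot k n.+1) -> E} :=
  uea_lift jet2_linear jet2_lie.

(** The terms with the square of the corner matrix vanish, and the top element has
    trace zero, so only the two mixed products are left. *)
Lemma jet2_hom_sq : jet2_hom (uea_inj (gv k n.+1 n)) ^+ 2 = 2 *: corner_tensor.
Proof.
have trn : \tr corner_mx = 0.
  by rewrite -jet_top trace_jet eqn0Ngt n_gt0 mul0r.
rewrite [jet2_hom _]uea_lift_inj /jet2 jet_top trn mulr0 scale0r addr0 expr2.
rewrite coprimitiveM -[corner_mx * _]/(corner_mx *m corner_mx) corner_mx_sq.
by rewrite linear0 add0r scaler_nat.
Qed.

Lemma jet2_homl i : jet2_hom (uea_inj (gv k n.+1 i)) * corner_tensor =
  (i == 0%N)%:R * (2 * n.+1%:R + mu * 'C(n.+2, 2)%:R) *: corner_tensor.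
Proof.
rewrite [jet2_hom _]uea_lift_inj /jet2 /corner_tensor mulrDl mulrDl !tpureM !mul1r.
rewrite -[_ * corner_mx]/(jet i *m corner_mx) jet_corner_mx tpureZl tpureZr.
rewrite -scalerAl mul1r.
rewrite -!scalerDl trace_jet natrM; congr (_ *: _); ring.
Qed.

Lemma jet2_homr i : corner_tensor * jet2_hom (uea_inj (gv k n.+1 i)) =
  (i == 0%N)%:R * (2 + mu * 'C(n.+2, 2)%:R) *: corner_tensor.
Proof.
rewrite [jet2_hom _]uea_lift_inj /jet2 /corner_tensor mulrDr mulrDr !tpureM !mulr1.
rewrite -[corner_mx * _]/(corner_mx *m jet i) corner_mx_jet tpureZl tpureZr.
rewrite -scalerAr mulr1.
rewrite -!scalerDl trace_jet; congr (_ *: _); ring.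
Qed.

End Twist.

End JetTensorSquare.

(** * A functional that detects the square of the top element *)

Section TensorFunctional.
Variables (k : fieldType) (A B : lmodType k).

Section Def.
Variables (f : {linear A -> k^o}) (g : {linear B -> k^o}).

Lemma tensor_fun_linl b : linear (fun a => f a * g b : k^o).
Proof. by move=> s a a'; rewrite linearP mulrDl -scalerAl. Qed.
Lemma tensor_fun_linr a : linear (fun b => f a * g b : k^o).
Proof. by move=> s b b'; rewrite linearP mulrDr -scalerAr. Qed.
Definition tensor_fun : {linear tensor A B -> k^o} :=
  tensor_lift tensor_fun_linl tensor_fun_linr.

Lemma tensor_funE a b : tensor_fun (tpure a b) = f a * g b.
Proof. exact: tensor_lift_pure. Qed.
End Def.

Lemma tpure_neq0 (a : A) (b : B) : a != 0 -> b != 0 -> tpure a b != 0.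
Proof.
move=> /exists_functional[f fa] /exists_functional[g gb].
apply/eqP => /(congr1 (tensor_fun f g)); rewrite tensor_funE fa gb linear0.
by rewrite mulr1 => /eqP; rewrite oner_eq0.
Qed.

End TensorFunctional.

Lemma char0_natr_neq0 (k : fieldType) (char0 : [pchar k] =i pred0) m :
  (0 < m)%N -> m%:R != 0 :> k.
Proof. by case: m => // m _; exact: char0_nat_neq0. Qed.

(** In the twisted tensor square v_n^2 is a nonzero multiple of E (x) E with E the
    corner matrix, and a product of v_i with E (x) E, on either side, is a multiple
    of E (x) E.  The twist makes the scalar on the right of v_n^2 equal to any c;
    the one on the left differs by 2 n, as [v_0, v_n^2] = 2 n v_n^2. *)
Lemma top_sq_functional (k : fieldType) (char0 : [pchar k] =i pred0) (n : nat)
    (n_gt0 : (0 < n)%N) (c : k) :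
  let v i := uea_inj (gv k n.+1 i) in
  exists phi : {linear uea (gquot k n.+1) -> k^o},
  [/\ phi (v n ^+ 2) = 1,
      forall i b, phi (b * v n ^+ 2 * v i) =
                  (i == 0%N)%:R * c * phi (b * v n ^+ 2)
    & forall i b, phi (v i * v n ^+ 2 * b) =
                  (i == 0%N)%:R * (c + (2 * n)%:R) * phi (v n ^+ 2 * b)].
Proof.
move=> v.
have bin0 : 'C(n.+2, 2)%:R != 0 :> k.
  by rewrite (char0_natr_neq0 char0) // bin_gt0.
(* Without the twist v_0 acts on the right of E (x) E by 2, and its trace is the
   binomial coefficient, the sum of 1, ..., n+1. *)
pose mu : k := (c - 2) / 'C(n.+2, 2)%:R.
pose R := jet2_hom n mu.
have Rv : R (v n ^+ 2) = 2 *: corner_tensor k n.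
  by rewrite rmorphXn; exact: jet2_hom_sq.
have Rl i : R (v i * v n ^+ 2) =
    ((i == 0%N)%:R * (c + (2 * n)%:R)) *: R (v n ^+ 2).
  rewrite rmorphM /= !Rv -scalerAr [_ * corner_tensor _ _]jet2_homl !scalerA.
  rewrite mulrC; congr (_ *: _).
  by rewrite /mu divfK // natrM -[n.+1]addn1 natrD; ring.
have Rr i : R (v n ^+ 2 * v i) = ((i == 0%N)%:R * c) *: R (v n ^+ 2).
  rewrite rmorphM /= !Rv -scalerAl [corner_tensor _ _ * _]jet2_homr !scalerA.
  by rewrite mulrC; congr (_ *: _); rewrite /mu divfK //; ring.
have e0 : R (v n ^+ 2) != 0.
  have corner0 : corner_mx k n != 0.
    apply/eqP => /matrixP/(_ ord_max ord0); rewrite !mxE !eqxx /=.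
    by apply/eqP; rewrite oner_eq0.
  by rewrite Rv scaler_eq0 negb_or (char0_natr_neq0 char0) // tpure_neq0.
have [psi psi1] := exists_functional e0.
have RM x y : R (x * y) = R x * R y by rewrite rmorphM.
clearbody R; exists (psi \o R); split=> //= i b.
- by rewrite -mulrA RM Rr -scalerAr [RHS]/= linearZ /= -RM.
- by rewrite RM Rl -scalerAl linearZ /= -RM.
Qed.

(** * Divided powers under an antisymmetric difference *)

Section AntiDiff.
Variables (k : fieldType) (V : zmodType).
Implicit Types (F G : {poly k} -> {poly k} -> V) (f g : {poly k}).

(** The bilinear expression (f, g) |-> F f g multiplied by the difference y - x of
    two variables, where x acts on f and y on g: iterating it N times multiplies by
    (y - x)^N, which lies in the N-th power of the ideal of the diagonal. *)
Definition antidiff F : {poly k} -> {poly k} -> V :=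
  fun f g => F f ('X * g) - F ('X * f) g.

Lemma iter_antidiff_sum (I : finType) (F : I -> {poly k} -> {poly k} -> V) N f g :
  iter N antidiff (fun f g => \sum_i F i f g) f g =
  \sum_i iter N antidiff (F i) f g.
Proof. by elim: N f g => // N IH f g; rewrite /= /antidiff !IH -sumrB. Qed.

Lemma iter_antidiffD F G N f g :
  iter N antidiff (fun f g => F f g + G f g) f g =
  iter N antidiff F f g + iter N antidiff G f g.
Proof. by elim: N f g => // N IH f g; rewrite /= /antidiff !IH opprD addrACA. Qed.

End AntiDiff.

Lemma iter_antidiff_morph (k : fieldType) (V W : zmodType) (L : V -> W)
    (F : {poly k} -> {poly k} -> V) N f g :
  {morph L : x y / x - y} ->
  iter N (@antidiff k W) (fun f g => L (F f g)) f g =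
  L (iter N (@antidiff k V) F f g).
Proof. by move=> LB; elim: N f g => // N IH f g; rewrite /= /antidiff !IH LB. Qed.

Section DividedPowers.
Variables (k : fieldType) (char0 : [pchar k] =i pred0).
Implicit Types f g : {poly k}.

Lemma dpder_mulX p f :
  dpder p.+1 ('X * f) = 'X * dpder p.+1 f + dpder p f.
Proof.
rewrite /dpder mulrC -[f * 'X]addr0 -[0]/(0%:P) derivnMXaddC.
rewrite scalerDr addrC scalerAl mulrC; congr (_ + _).
rewrite -scaler_nat scalerA factS natrM invfM mulrAC mulVf ?mul1r //.
exact: char0_nat_neq0.
Qed.

Lemma dpder_Xn p : dpder p ('X^p : {poly k}) = 1.
Proof.
elim: p => [|p IH]; first by rewrite expr0 dpder0.
rewrite exprS dpder_mulX IH.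
by rewrite /dpder derivnXn ffact_small // mulr0n scaler0 mulr0 add0r.
Qed.

Lemma dpder_Xn_eq0 p q : (p < q)%N -> dpder q ('X^p : {poly k}) = 0.
Proof. by move=> pq; rewrite /dpder derivnXn ffact_small // mulr0n scaler0. Qed.

Definition dpder2 p q f g : {poly k} := dpder p f * dpder q g.

(** By the Leibniz rule [dpder_mulX] the two terms in which t is not hit by a
    derivative cancel. *)
Lemma antidiff_dpder2 p q : antidiff (dpder2 p q) = fun f g =>
  (if q is q'.+1 then dpder2 p q' f g else 0) -
  (if p is p'.+1 then dpder2 p' q f g else 0).
Proof.
apply: funext => f; apply: funext => g; rewrite /antidiff /dpder2.
case: p q => [|p] [|q]; rewrite ?dpder_mulX ?dpder0; ring.
Qed.

(** Each step lowers the order p + q by one, taking it off p (with a sign) or off q;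
    in order N the number of ways to reach order 0 is a binomial coefficient, and
    in smaller order an index runs out. *)
Lemma iter_antidiff_dpder2 N p q f g : (p + q <= N)%N ->
  iter N (@antidiff k {poly k}) (dpder2 p q) f g =
  if (p + q == N)%N then ((-1) ^+ p * 'C(N, p)%:R) *: (f * g) else 0.
Proof.
elim: N p q f g => [|N IH] p q f g.
  rewrite leqn0 addn_eq0 => /andP[/eqP-> /eqP->].
  by rewrite /= /dpder2 !dpder0 mul1r scale1r.
move=> pq; rewrite iterSr antidiff_dpder2.
have aN F G : iter N (@antidiff k {poly k}) (fun f g => F f g - G f g) f g =
    iter N (@antidiff k {poly k}) F f g - iter N (@antidiff k {poly k}) G f g.
  rewrite iter_antidiffD; congr (_ + _).
  rewrite -(@iter_antidiff_morph k {poly k} {poly k} -%R) // => x y.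
  by rewrite opprD.
have a0 : iter N (@antidiff k {poly k}) (fun _ _ => 0) f g = 0.
  by elim: (N) (f) (g) => //= M IHM f' g'; rewrite /antidiff !IHM subrr.
case: p q pq => [|p] [|q] pq; rewrite aN ?a0.
- by rewrite subrr.
- by rewrite IH // subr0 !add0n eqSS !bin0.
- rewrite addn0 in pq *; rewrite IH addn0 // eqSS sub0r.
  case: eqP => [->|_]; last by rewrite oppr0.
  by rewrite !binn exprS mulN1r mulNr scaleNr.
have pq1 : (p.+1 + q <= N)%N by rewrite -ltnS -addnS.
have pq2 : (p + q.+1 <= N)%N by rewrite -ltnS -addSn.
rewrite !IH // [(p.+1 + q.+1)%N]addSn eqSS addSnnS.
case: eqP => [_|_]; last by rewrite subrr.
rewrite -scalerBl exprS binS natrD; congr (_ *: _); ring.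
Qed.

End DividedPowers.

(** * Generators of the orbit algebra *)

Section OrbitAlgebra.
Variables (k : fieldType) (n : nat).
Local Notation T := (orbit_alg k n).
Implicit Types x y : T.

Lemma gquot_span m (u : gquot k m) :
  exists c : nat -> k, u = \sum_(i < m) c i *: gv k m i.
Proof.
have -> : u = gpi m (repr u) by rewrite gpi_reprK.
move: (repr u) => f; exists (fun i => (val f : {poly k})`_i.+1).
have -> : \sum_(i < m) (val f : {poly k})`_i.+1 *: gv k m i =
    gpi m (\sum_(i < m) (val f : {poly k})`_i.+1 *: witt_e k i).
  rewrite (big_morph (@gpi k m) (@gpiD k m) (@gpi0 k m)).
  by apply: eq_bigr => i _; rewrite gpiZ.
apply/gpiP; rewrite unfold_in unfold_in raddfB raddf_sum /=.
case: f => f /=; rewrite unfold_in expr1 => /dvdpP[q f0].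
have {f0} f0 : (f : {poly k})`_0 = 0 by rewrite f0 coefMX.
apply/dvdpP; exists (drop_poly m.+1 f).
apply/eqP; rewrite subr_eq addrC; apply/eqP.
rewrite -[LHS](poly_take_drop m.+1) /take_poly poly_def big_ord_recl f0 scale0r.
by rewrite add0r.
Qed.

Lemma orbit_alg_ind (Q : T -> Prop) :
  (forall f, Q (Tpoly n f)) -> Q (Td k n) ->
  (forall i, Q (Tv k n i)) ->
  (forall x y, Q x -> Q y -> Q (x + y)) ->
  (forall x y, Q x -> Q y -> Q (x * y)) -> forall x, Q x.
Proof.
move=> Qf Qd Qv QD QM.
have QZ c x : Q x -> Q (c *: x).
  move=> Qx; rewrite -[x]mul1r scalerAl; apply: QM => //.
  have -> : c *: 1 = Tpoly n c%:P.
    by rewrite /Tpoly horner_algC tpureZl.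
  exact: Qf.
elim/tensor_ind => [a b|]; last exact: QD.
have -> : tpure a b = tpure a 1 * tpure 1 b :> T by rewrite tpureM mulr1 mul1r.
apply: (QM).
- elim/palg_ind: a => [c|[]|a a' Qa Qa'|a a' Qa Qa'].
  + by rewrite tpureZl; apply: QZ; have := Qf 1; rewrite /Tpoly rmorph1.
  + by have := Qf 'X; rewrite /Tpoly horner_algX.
  + exact: Qd.
  + by rewrite tpureDl; apply: QD.
  + by have := QM _ _ Qa Qa'; rewrite tpureM mulr1.
- elim/palg_ind: b => [c|u|b b' Qb Qb'|b b' Qb Qb'].
  + by rewrite tpureZr; apply: QZ; have := Qf 1; rewrite /Tpoly rmorph1.
  + rewrite -[palg_gen u]/(uea_inj u); have [c ->] := gquot_span u.
    rewrite linear_sum; elim/big_ind: _ => [||i _].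
    * by rewrite tpure0r; have := Qf 0; rewrite linear0.
    * by move=> b b' Qb Qb'; rewrite tpureDr; apply: QD.
    * by rewrite linearZ tpureZr; apply/QZ/Qv.
  + by rewrite tpureDr; apply: QD.
  + by have := QM _ _ Qb Qb'; rewrite tpureM mulr1.
Qed.

End OrbitAlgebra.

(** * Products of orbit images and the square of the top element *)

Section OrbitImage.
Variables (k : fieldType) (char0 : [pchar k] =i pred0) (n : nat).
Local Notation T := (orbit_alg k n.+1).
Local Notation Tp := (@Tpoly k n.+1).
Local Notation v := (Tv k n.+1 n).
Local Notation Psi := (orbit_fun n.+1).
Implicit Types (f g h : {poly k}) (x y w : T).

Lemma Tv_top i : Tv k n.+1 i * v = v * Tv k n.+1 i + ((i == 0%N)%:R * n%:R) *: v.
Proof.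
apply/eqP; rewrite addrC -subr_eq Tv_lie; apply/eqP.
case: i => [|i]; first by rewrite subr0 mul1r.
by rewrite Tv_eq0 ?scaler0 ?mul0r ?scale0r // addSn ltnS leq_addl.
Qed.

Lemma Tv_top_sq i : Tv k n.+1 i * v ^+ 2 =
  v ^+ 2 * Tv k n.+1 i + ((i == 0%N)%:R * (2 * n)%:R) *: v ^+ 2.
Proof.
rewrite expr2 mulrA Tv_top mulrDl -mulrA Tv_top mulrDr !mulrA -addrA.
by rewrite -scalerAl -scalerAr -scalerDl -mulrDr -natrD mul2n addnn.
Qed.

Lemma top_sq_Tpoly f : v ^+ 2 * Tp f = Tp f * v ^+ 2.
Proof. by rewrite expr2 -mulrA Tpoly_Tv !mulrA Tpoly_Tv. Qed.

Lemma top_sq_Td : v ^+ 2 * Td k n.+1 = Td k n.+1 * v ^+ 2.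
Proof. by rewrite expr2 -mulrA Td_Tv !mulrA Td_Tv. Qed.

(** Multiplication past v_n^2 shifts v_0 by the scalar 2 n and fixes the other
    generators. *)
Lemma top_sq_normalr x : exists y, x * v ^+ 2 = v ^+ 2 * y.
Proof.
elim/orbit_alg_ind: x => [f||i|x x' [y e] [y' e']|x x' [y e] [y' e']].
- by exists (Tp f); rewrite top_sq_Tpoly.
- by exists (Td k n.+1); rewrite top_sq_Td.
- exists (Tv k n.+1 i + ((i == 0%N)%:R * (2 * n)%:R)%:A).
  by rewrite Tv_top_sq mulrDr -scalerAr mulr1.
- by exists (y + y'); rewrite mulrDl mulrDr e e'.
- by exists (y * y'); rewrite -[LHS]mulrA e' [LHS]mulrA e -[LHS]mulrA.
Qed.

Lemma top_sq_normall x : exists y, v ^+ 2 * x = y * v ^+ 2.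
Proof.
elim/orbit_alg_ind: x => [f||i|x x' [y e] [y' e']|x x' [y e] [y' e']].
- by exists (Tp f); rewrite top_sq_Tpoly.
- by exists (Td k n.+1); rewrite top_sq_Td.
- exists (Tv k n.+1 i - ((i == 0%N)%:R * (2 * n)%:R)%:A).
  by rewrite mulrBl Tv_top_sq -scalerAl mul1r addrK.
- by exists (y + y'); rewrite mulrDl mulrDr e e'.
- by exists (y * y'); rewrite [LHS]mulrA e -[LHS]mulrA e' [LHS]mulrA.
Qed.

(** Treating d/dt as v_(-1) puts the two kinds of terms of [orbit_fun] on the same
    footing. *)
Definition Tsym p : T := if p is i.+1 then Tv k n.+1 i else Td k n.+1.

Lemma orbit_funE f : Psi f = \sum_(p < n.+2) Tp (dpder p f) * Tsym p.
Proof. by rewrite big_ord_recl /= dpder0. Qed.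

Lemma Tsym_Tpoly p f :
  Tsym p * Tp f = Tp f * Tsym p + Tp (if p is 0 then f^`() else 0).
Proof.
case: p => [|i] /=; first exact: Td_Tpoly.
by rewrite linear0 addr0 Tpoly_Tv.
Qed.

(** Let L be the set of y with k[t] y inside J.  It is stable under d/dt = e(1) and
    under t, and by induction on p under v_(p-1), because e(t^p) equals v_(p-1) plus
    terms with smaller symbols.  Thus L is a left ideal of the whole algebra. *)
Lemma orbit_fun_fill (J : set T) w :
  J 0 -> (forall x y, J x -> J y -> J (x - y)) ->
  (forall f x, J x -> J (Psi f * x)) ->
  (forall f, J (Tp f * w)) -> forall x, J (x * w).
Proof.
move=> J0 JB JPsi Jw.
have JD x y : J x -> J y -> J (x + y).
  by move=> Jx Jy; rewrite -[y]opprK -[- y]sub0r; apply/JB/JB.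
have Jsum (I : finType) (P : pred I) (F : I -> T) :
    (forall i, P i -> J (F i)) -> J (\sum_(i | P i) F i).
  by move=> JF; elim/big_ind: _.
pose L y := forall f, J (Tp f * y).
have Lp f y : L y -> L (Tp f * y).
  by move=> Ly g; rewrite mulrA -TpolyM.
have Lsym p y : L y -> L (Tsym p * y).
  elim/ltn_ind: p y => p IH y Ly.
  have [pn|pn] := ltnP p n.+2; last first.
    case: p pn {IH} => // p pn f.
    by rewrite /= Tv_eq0 // mul0r mulr0.
  have Jy f : J (Tsym p * (Tp f * y)).
    have := JPsi 'X^p _ (Ly f).
    rewrite orbit_funE (bigD1 (Ordinal pn)) //= dpder_Xn // /Tpoly.
    rewrite rmorph1 mul1r mulrDl => Je.
    (* The coefficient of the symbol p in e(t^p) is 1; the rest is subtracted. *)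
    rewrite -[X in J X](addrK (\sum_(i < n.+2 | i != Ordinal pn)
       Tp (dpder i 'X^p) * Tsym i * (Tp f * y))).
    rewrite -mulr_suml; apply: JB Je _; rewrite mulr_suml; apply: Jsum => i ip.
    have [lip|] := ltnP i p.
      by rewrite -mulrA; apply: IH lip _ (Lp f y Ly) _.
    rewrite leq_eqVlt => /predU1P[e|lt].
      by case/eqP: ip; apply: val_inj.
    by rewrite dpder_Xn_eq0 // linear0 !mul0r.
  move=> f; have := Jy f; rewrite mulrA Tsym_Tpoly mulrDl => Je.
  rewrite mulrA -[X in J X](addrK (Tp (if p is 0 then f^`() else 0) * y)).
  exact: JB Je (Ly _).
suff LT x y : L y -> L (x * y).
  by move=> x; have := LT x w Jw 1; rewrite {1}/Tpoly rmorph1 mul1r.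
move=> {w Jw}.
elim/orbit_alg_ind: x y => [f||i|x x' Lx Lx'|x x' Lx Lx'] y Ly.
- exact: Lp.
- exact: (Lsym 0).
- exact: (Lsym i.+1).
- by move=> f; rewrite mulrDl mulrDr; apply: JD; [apply: Lx|apply: Lx'].
- by rewrite -mulrA; apply/Lx/Lx'.
Qed.

(** The second sum is what d/dt, the symbol of index 0, leaves when it is moved to
    the right of D_q(g), since D_q(g)' = (q+1) D_(q+1)(g). *)
Lemma orbit_funM f g : Psi f * Psi g =
  \sum_(p < n.+2) \sum_(q < n.+2) Tp (dpder2 p q f g) * (Tsym p * Tsym q) +
  \sum_(q < n.+2) Tp (dpder2 0 q.+1 f g) * (q.+1%:R *: Tsym q).
Proof.
rewrite !orbit_funE mulr_suml.
pose D p h : {poly k} := if p is 0 then h^`() else 0.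
have e p q : Tp (dpder p f) * Tsym p * (Tp (dpder q g) * Tsym q) =
    Tp (dpder2 p q f g) * (Tsym p * Tsym q) +
    Tp (dpder p f * D p (dpder q g)) * Tsym q.
  rewrite /dpder2 mulrA -[_ * Tsym p * _]mulrA Tsym_Tpoly -/(D p _).
  by rewrite mulrDr mulrDl !mulrA -!TpolyM -!mulrA.
under eq_bigr => p _.
  rewrite mulr_sumr; under eq_bigr => q _ do rewrite e.
  rewrite big_split; over.
rewrite big_split /=; congr (_ + _).
rewrite big_ord_recl /= [X in _ + X]big1 ?addr0 => [|p _]; last first.
  by rewrite big1 // => q _; rewrite mulr0 linear0 mul0r.
apply: eq_bigr => q _; rewrite deriv_dpder // /dpder2.
move: (dpder 0 f) (dpder q.+1 g) => a b.
by rewrite -[a * _]scalerAr [Tp (_ *: _)]linearZ -scalerAl -scalerAr.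
Qed.

(** The exponent 2 (n+1) is the order of the single term p = q = n+1 of
    [orbit_funM]; all other terms have smaller order.  For those of the second sum,
    of order at most n+2, this needs n > 0. *)
Lemma iter_antidiff_orbit_fun f g : (0 < n)%N ->
  iter (2 * n.+1) (@antidiff k T) (fun f g => Psi f * Psi g) f g =
  ((-1) ^+ n.+1 * 'C(2 * n.+1, n.+1)%:R) *: (Tp (f * g) * v ^+ 2).
Proof.
move=> n0; move EN: (2 * n.+1)%N => N; rewrite mul2n -addnn in EN.
have -> : (fun f g => Psi f * Psi g) = fun f g =>
    \sum_(p < n.+2) \sum_(q < n.+2) Tp (dpder2 p q f g) * (Tsym p * Tsym q) +
    \sum_(q < n.+2) Tp (dpder2 0 q.+1 f g) * (q.+1%:R *: Tsym q).
  by apply: funext => f'; apply: funext => g'; exact: orbit_funM.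
have aL p q w : (p + q <= N)%N ->
    iter N (@antidiff k T) (fun f g => Tp (dpder2 p q f g) * w) f g =
    (if (p + q == N)%N then ((-1) ^+ p * 'C(N, p)%:R) else 0) *:
    (Tp (f * g) * w).
  move=> pq.
  rewrite (@iter_antidiff_morph k {poly k} T (fun h => Tp h * w)); last first.
    by move=> x y; rewrite linearB mulrBl.
  rewrite iter_antidiff_dpder2 //; case: eqP => _; last first.
    by rewrite linear0 mul0r scale0r.
  by rewrite [Tp (_ *: _)]linearZ scalerAl.
rewrite iter_antidiffD !iter_antidiff_sum.
rewrite [X in _ + X]big1 ?addr0 => [|q _]; last first.
  have lq : (0 + q.+1 < N)%N.
    rewrite add0n (leq_ltn_trans (ltn_ord q)) // -EN.
    by rewrite -[n.+2]addn1 ltn_add2l ltnS.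
  by rewrite aL ?(ltnW lq) // ltn_eqF // scale0r.
under eq_bigr => p _ do rewrite iter_antidiff_sum.
rewrite big_ord_recr /= [X in X + _]big1 ?add0r => [|p _]; last first.
  apply: big1 => q _; have lq : (p + q < N)%N.
    by rewrite -EN -addSn leq_add // -ltnS ltn_ord.
  by rewrite aL ?(ltnW lq) // ltn_eqF // scale0r.
rewrite big_ord_recr /= [X in X + _]big1 ?add0r => [|q _]; last first.
  have lq : (n.+1 + q < N)%N by rewrite -EN ltn_add2l.
  by rewrite aL ?(ltnW lq) // ltn_eqF // scale0r.
by rewrite aL EN // eqxx -expr2.
Qed.

End OrbitImage.

(** * A criterion for an ideal not to be finitely generated *)

Definition coord_span (k : fieldType) (T : Type) (I : set T)
    (eta : nat -> T -> k) N (w : 'I_N -> nat -> k) : set T :=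
  [set x | I x /\ exists c : 'I_N -> k, forall m, eta m x = \sum_i c i * w i m].

(** If I is generated by s and [coord_span] of the coordinates of s is itself an
    ideal of the kind considered, then all coordinate sequences of I lie in a space
    of dimension at most the size of s; but they contain the unit sequences. *)
Lemma not_finitely_generated (k : fieldType) (T : algType k) (C : set (set T))
    (I : set T) (eta : nat -> T -> k) (e : nat -> T) :
  (forall j, I (e j)) -> (forall m j, eta m (e j) = (m == j)%:R) ->
  (forall N (w : 'I_N -> nat -> k), C (coord_span I eta w)) ->
  forall s : seq T, I <> smallest C [set` s].
Proof.
move=> Ie etae Cspan s Is.
have sI x : x \in s -> I x by move=> xs; rewrite Is => M [_]; apply.
pose N := size s; pose w (i : 'I_N) m := eta m s`_i.
have IJ x : I x -> exists c : 'I_N -> k, forall m, eta m x = \sum_i c i * w i m.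
  move=> Ix; suff [] : coord_span I eta w x by [].
  move: Ix; rewrite {1}Is; apply; split; first exact: Cspan.
  move=> y /= ys; split; first exact: sI.
  have yN : (index y s < N)%N by rewrite index_mem.
  exists (fun i => (i == Ordinal yN)%:R) => m.
  rewrite (bigD1 (Ordinal yN)) //= big1 => [|i /negbTE->]; last by rewrite mul0r.
  by rewrite eqxx mul1r addr0 /w /= nth_index.
have [c cE] := choice (fun j : 'I_N.+1 => IJ _ (Ie j)).
(* N + 1 unit sequences, cut off after N + 1 terms, would be combinations of N
   vectors. *)
pose A : 'M[k]_(N.+1, N) := \matrix_(j, i) c j i.
pose W : 'M[k]_(N, N.+1) := \matrix_(i, m) w i m.
have AW : A *m W = 1%:M.
  apply/matrixP => j m; rewrite !mxE.
  under eq_bigr do rewrite !mxE.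
  by rewrite -cE etae eq_sym.
by have := mulmx1_min AW; rewrite ltnn.
Qed.

Section Functionals.
Variable k : fieldType.

Definition poly_coef m (a : weyl k) : k^o := (poly_act a 1)`_m.
Lemma poly_coef_linear m : linear (poly_coef m).
Proof. by move=> c a b; rewrite /poly_coef poly_act_linl coefD coefZ. Qed.
HB.instance Definition _ m :=
  GRing.isLinear.Build k (weyl k) k^o _ (poly_coef m) (poly_coef_linear m).

Definition fourier_coef m (a : weyl k) : k^o := (fourier_act a 'X^m)`_0.
Lemma fourier_coef_linear m : linear (fourier_coef m).
Proof. by move=> c a b; rewrite /fourier_coef fourier_act_linl coefD coefZ. Qed.
HB.instance Definition _ m :=
  GRing.isLinear.Build k (weyl k) k^o _ (fourier_coef m) (fourier_coef_linear m).

End Functionals.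

(** * The ideal generated by the square of the top element *)

Section MainTheorem.
Variables (k : fieldType) (char0 : [pchar k] =i pred0) (n : nat).
Hypothesis n_gt0 : (0 < n)%N.
Local Notation T := (orbit_alg k n.+1).
Local Notation Tp := (@Tpoly k n.+1).
Local Notation v := (Tv k n.+1 n).
Local Notation Psi := (orbit_fun n.+1).
Local Notation B := (orbit_image n.+1 char0).
Local Notation Phi := (orbit_hom n.+1 char0).
Implicit Types (f g h : {poly k}) (x y w : T).

Definition top_sq_ideal : set T := [set x * v ^+ 2 | x in [set: T]].
Local Notation I := top_sq_ideal.

Lemma orbit_image_ind (Q : T -> Prop) :
  (forall c : k, Q c%:A) -> (forall f, Q (Psi f)) ->
  (forall x y, Q x -> Q y -> Q (x + y)) ->
  (forall x y, Q x -> Q y -> Q (x * y)) -> forall b, B b -> Q b.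
Proof.
move=> Qc Qf QD QM b [u _ <-].
elim/palg_ind: u => [c|f|u u' Qu Qu'|u u' Qu Qu'].
- have -> : Phi c%:A = c%:A by rewrite linearZ rmorph1.
  exact: Qc.
- by rewrite [Phi _]orbit_homE; exact: Qf.
- by rewrite rmorphD; exact: QD.
- by rewrite rmorphM; exact: QM.
Qed.

Lemma orbit_image_fun f : B (Psi f).
Proof. by exists (uea_inj (f : witt k)) => //; exact: orbit_homE. Qed.
Lemma orbit_imageB x y : B x -> B y -> B (x - y).
Proof. by move=> [u _ <-] [u' _ <-]; exists (u - u') => //; rewrite rmorphB. Qed.
Lemma orbit_imageM x y : B x -> B y -> B (x * y).
Proof. by move=> [u _ <-] [u' _ <-]; exists (u * u') => //; rewrite rmorphM. Qed.
Lemma orbit_image_cst (c : k) : B c%:A.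
Proof. by exists c%:A => //; rewrite linearZ rmorph1. Qed.
Lemma orbit_imageZ (c : k) x : B x -> B (c *: x).
Proof.
move=> Bx; rewrite -[x]mul1r scalerAl.
exact: orbit_imageM (orbit_image_cst c) Bx.
Qed.
Lemma orbit_image0 : B 0.
Proof. by have := orbit_image_cst 0; rewrite scale0r. Qed.

(** The iterated difference of e(f) e(1) stays in the image, and it is a nonzero
    multiple of f v_n^2. *)
Lemma Tpoly_top_sq_image f : B (Tp f * v ^+ 2).
Proof.
have Banti N F : (forall f g, B (F f g)) ->
    forall f g, B (iter N (@antidiff k T) F f g).
  by move=> BF; elim: N => //= N IH f' g'; apply: orbit_imageB.
have := Banti (2 * n.+1)%N (fun f g => Psi f * Psi g) _ f 1.
rewrite iter_antidiff_orbit_fun // mulr1 => /(_ _)/(@orbit_imageZ _^-1) BT.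
have c0 : (-1) ^+ n.+1 * 'C(2 * n.+1, n.+1)%:R != 0 :> k.
  by rewrite mulf_neq0 ?signr_eq0 // (char0_natr_neq0 char0) // bin_gt0 leq_pmull.
have := BT ((-1) ^+ n.+1 * 'C(2 * n.+1, n.+1)%:R).
rewrite scalerA mulVf // scale1r; apply.
by move=> *; apply: orbit_imageM; exact: orbit_image_fun.
Qed.

Lemma top_sq_ideal_image : I `<=` B.
Proof.
move=> _ [x _ <-]; apply: (@orbit_fun_fill _ char0 n B).
- exact: orbit_image0.
- exact: orbit_imageB.
- by move=> f y; apply/orbit_imageM/orbit_image_fun.
- exact: Tpoly_top_sq_image.
Qed.

Lemma top_sq_ideal0 : I 0.
Proof. by exists 0 => //; rewrite mul0r. Qed.
Lemma top_sq_idealB x y : I x -> I y -> I (x - y).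
Proof. by move=> [a _ <-] [b _ <-]; exists (a - b) => //; rewrite mulrBl. Qed.
Lemma top_sq_idealMl y x : I x -> I (y * x).
Proof. by move=> [a _ <-]; exists (y * a) => //; rewrite -mulrA. Qed.
Lemma top_sq_idealMr y x : I x -> I (x * y).
Proof.
move=> [a _ <-]; have [z e] := top_sq_normall y.
by exists (a * z) => //; rewrite -[LHS]mulrA -[RHS]mulrA e.
Qed.

Lemma top_sq_ideal_two_sided S : I `<=` S -> two_sided_ideal S I.
Proof.
move=> IS; split; split=> //; try exact: top_sq_ideal0; try exact: top_sq_idealB.
- by move=> s x _; exact: top_sq_idealMl.
- by move=> s x _; exact: top_sq_idealMr.
Qed.

Lemma top_sq_ideal_gen : I (v ^+ 2).
Proof. by exists 1 => //; rewrite mul1r. Qed.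

(** For a set S that contains I, only minimality of I among the ideals of S is at
    stake, since I is an ideal of the whole algebra. *)
Lemma top_sq_generates S : I `<=` S ->
  (forall J, two_sided_ideal S J -> J (v ^+ 2) -> I `<=` J) ->
  generates_two_sided S I (v ^+ 2).
Proof.
move=> IS Imin; split; first exact/IS/top_sq_ideal_gen.
apply/seteqP; split=> [x Ix J [JS Jv]|x].
  by apply: Imin Ix => //; apply: Jv.
apply; split; first exact: top_sq_ideal_two_sided.
by move=> _ ->; exact: top_sq_ideal_gen.
Qed.

Lemma orbit_fun_top_sq f : Psi f * v ^+ 2 - v ^+ 2 * Psi f =
  (2 * n)%:R *: (Tp f^`() * v ^+ 2).
Proof.
rewrite /orbit_fun mulrDl mulrDr opprD addrACA -[_ * Td _ _ * _]mulrA.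
rewrite -top_sq_Td mulrA -top_sq_Tpoly -mulrA subrr add0r.
have e i g : Tp g * Tv k n.+1 i * v ^+ 2 - v ^+ 2 * (Tp g * Tv k n.+1 i) =
    ((i == 0%N)%:R * (2 * n)%:R) *: (Tp g * v ^+ 2).
  have eT : Tv k n.+1 i * v ^+ 2 - v ^+ 2 * Tv k n.+1 i =
      ((i == 0%N)%:R * (2 * n)%:R) *: v ^+ 2 by rewrite Tv_top_sq addrC addKr.
  move: (v ^+ 2) eT (@top_sq_Tpoly k n g) => w eT wg.
  by rewrite [X in _ - X]mulrA wg -!mulrA -mulrBr eT -scalerAr.
rewrite mulr_suml mulr_sumr -sumrB big_ord_recl big1 ?addr0 => [|i _].
  by rewrite e dpder1 mul1r.
by rewrite e mul0r scale0r.
Qed.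

Lemma antiderivative h : exists f, f^`() = h.
Proof.
exists (\poly_(i < (size h).+1) (h`_i.-1 / i%:R)); apply/polyP => i.
rewrite coef_deriv coef_poly ltnS /=; case: ltnP => hi.
  by rewrite -[LHS]mulr_natr mulfVK // (char0_natr_neq0 char0).
by rewrite mul0rn nth_default.
Qed.

(** Commutators with e(f) turn v_n^2 into 2 n f' v_n^2, and every polynomial is a
    derivative. *)
Lemma top_sq_generates_image : generates_two_sided B I (v ^+ 2).
Proof.
apply: top_sq_generates => [|J [[JB J0 JS JMl] [_ _ _ JMr]] Jv _ [x _ <-]].
  exact: top_sq_ideal_image.
apply: (@orbit_fun_fill _ char0 n J) => // [f y|h].
  exact/JMl/orbit_image_fun.
have [f <-] := antiderivative h.
have c0 : (2 * n)%:R != 0 :> k by rewrite (char0_natr_neq0 char0) // muln_gt0.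
rewrite -[Tp _ * _]scale1r -(mulVf c0) -scalerA -orbit_fun_top_sq.
rewrite -[_ - _]mul1r scalerAl; apply: (JMl); first exact: orbit_image_cst.
by apply: JS; [apply: JMl|apply: JMr] => //; exact: orbit_image_fun.
Qed.

Lemma top_sq_generates_setT : generates_two_sided [set: T] I (v ^+ 2).
Proof.
apply: top_sq_generates => // J [[_ _ _ JMl] _] Jv _ [x _ <-].
exact: JMl.
Qed.

(** * Failure of finite generation *)

Section CoordSpan.
Variable eta : nat -> {linear T -> k^o}.

Local Notation J := (@coord_span k T I (fun m => eta m) _).

Lemma coord_span_closed N (w : 'I_N -> nat -> k) :
  [/\ J w 0, forall x y, J w x -> J w y -> J w (x - y),
      forall x y, J w x -> J w y -> J w (x + y),
      forall (c : k) x, J w x -> J w (c *: x)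
    & forall x, I x -> (forall m, eta m x = 0) -> J w x].
Proof.
have Jann x : I x -> (forall m, eta m x = 0) -> J w x.
  move=> Ix eta0; split=> //; exists (fun=> 0) => m.
  by rewrite eta0 big1 // => i _; rewrite mul0r.
have J0 : J w 0.
  by apply: Jann => [|m]; [exact: top_sq_ideal0|rewrite linear0].
have JB x y : J w x -> J w y -> J w (x - y).
  move=> [Ix [c xc]] [Iy [d yd]]; split; first exact: top_sq_idealB.
  exists (fun i => c i - d i) => m; rewrite linearB /= xc yd -sumrB.
  by apply: eq_bigr => i _; rewrite mulrBl.
split=> // [x y Jx Jy|c x [Ix [d xd]]].
  by rewrite -[y]opprK -[- y]sub0r; apply/JB/JB.
split.
  by rewrite -[x]mul1r scalerAl; exact: top_sq_idealMl.
exists (fun i => c * d i) => m; rewrite linearZ /= xd [LHS]mulr_sumr.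
by apply: eq_bigr => i _; rewrite mulrA.
Qed.

(** The image is generated by the e(f); if the functionals kill e(f) I, then
    multiplication by e(f) sends I to elements with zero coordinates. *)
Lemma coord_span_left_ideal N (w : 'I_N -> nat -> k) :
  (forall m f x, I x -> eta m (Psi f * x) = 0) -> left_ideal B (J w).
Proof.
move=> eta0; have [J0 JB JD JZ Jann] := coord_span_closed w.
split=> // [x [Ix _]|b x Bb]; first exact: top_sq_ideal_image.
move: b Bb x; apply: orbit_image_ind => [c|f|b b' Jb Jb'|b b' Jb Jb'] x Jx.
- by rewrite -scalerAl mul1r; exact: JZ.
- have [Ix _] := Jx; apply: Jann => [|m]; first exact: top_sq_idealMl.
  exact: eta0.
- by rewrite mulrDl; apply: JD; [exact: Jb|exact: Jb'].
- by rewrite -mulrA; apply/Jb/Jb'.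
Qed.

Lemma coord_span_right_ideal N (w : 'I_N -> nat -> k) :
  (forall m f x, I x -> eta m (x * Psi f) = 0) -> right_ideal B (J w).
Proof.
move=> eta0; have [J0 JB JD JZ Jann] := coord_span_closed w.
split=> // [x [Ix _]|b x Bb]; first exact: top_sq_ideal_image.
move: b Bb x; apply: orbit_image_ind => [c|f|b b' Jb Jb'|b b' Jb Jb'] x Jx.
- by rewrite -scalerAr mulr1; exact: JZ.
- have [Ix _] := Jx; apply: Jann => [|m]; first exact: top_sq_idealMr.
  exact: eta0.
- by rewrite mulrDr; apply: JD; [exact: Jb|exact: Jb'].
- by rewrite mulrA; apply/Jb'/Jb.
Qed.

End CoordSpan.

Lemma top_sqE : v ^+ 2 = tpure 1 (uea_inj (gv k n.+1 n) ^+ 2) :> T.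
Proof. by rewrite !expr2 tpureM mulr1. Qed.

Lemma Tpoly_Xn j : Tp 'X^j = tpure (weyl_t k ^+ j) 1.
Proof. by rewrite /Tpoly rmorphXn /= horner_algX. Qed.

(** For x v_n^2 e(f) to be killed, v_0 must act by 0 on the right of v_n^2: then the
    terms with the v_i vanish, and the term with d/dt vanishes since d/dt . 1 = 0. *)
Lemma top_sq_ideal_not_fg_right : ~ fg_right_ideal B I.
Proof.
move=> [s [_]].
have [phi [phi1 phiR _]] := top_sq_functional char0 n_gt0 0.
have [eta etaE] : exists eta : nat -> {linear T -> k^o},
    forall m a b, eta m (tpure a b) = (poly_act a 1)`_m * phi b.
  exists (fun m => tensor_fun (poly_coef m) phi) => m a b.
  exact: tensor_funE.
apply: (@not_finitely_generated k T (right_ideal B) I (fun m => eta m)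
  (fun j => Tp 'X^j * v ^+ 2)) => [j|m j|N w].
- by apply: top_sq_idealMl; exact: top_sq_ideal_gen.
- rewrite top_sqE Tpoly_Xn tpureM mulr1 mul1r etaE phi1 mulr1.
  by rewrite poly_act_tX coefXn.
apply: coord_span_right_ideal => m f _ [x _ <-].
elim/tensor_ind: x => [a b|x y IHx IHy]; last first.
  by rewrite !mulrDl linearD /= IHx IHy addr0.
rewrite top_sqE tpureM mulr1 /orbit_fun mulrDr linearD /=.
rewrite {1}/Tpoly /Td !tpureM !mulr1 mulrA etaE poly_act_d1 coef0 mul0r add0r.
rewrite mulr_sumr linear_sum big1 // => i _.
by rewrite /Tpoly /Tv !tpureM mul1r mulr1 /= etaE phiR mulr0 mul0r mulr0.
Qed.

(** For e(f) v_n^2 y to be killed, v_0 must act by 1 on the left of v_n^2: then e(f)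
    acts on the A_1-factor by f d/dt + f' = (d/dt) f, and the constant term in the
    Fourier transform kills the image of d/dt.  The
    elements t^j v_n^2 are divided by (-1)^j j! because t acts by - d/dt. *)
Lemma top_sq_ideal_not_fg_left : ~ fg_left_ideal B I.
Proof.
move=> [s [_]].
have [phi [phi1 _ phiL]] := top_sq_functional char0 n_gt0 (1 - (2 * n)%:R).
have [eta etaE] : exists eta : nat -> {linear T -> k^o},
    forall m a b, eta m (tpure a b) = fourier_coef m a * phi b.
  exists (fun m => tensor_fun (fourier_coef m) phi) => m a b.
  exact: tensor_funE.
apply: (@not_finitely_generated k T (left_ideal B) I (fun m => eta m)
  (fun j => ((-1) ^+ j * j`!%:R)^-1 *: (Tp 'X^j * v ^+ 2))) => [j|m j|N w].
- by rewrite scalerAl; apply: top_sq_idealMl; exact: top_sq_ideal_gen.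
- rewrite top_sqE Tpoly_Xn tpureM mulr1 mul1r linearZ /= etaE phi1 mulr1.
  rewrite /fourier_coef fourier_act_tX_Xn [_ *: _]mulrCA mulVf ?mulr1 //.
  by rewrite mulf_neq0 ?signr_eq0 // (char0_natr_neq0 char0) // fact_gt0.
apply: coord_span_left_ideal => m f _ [x _ <-].
have [y ->] := top_sq_normalr x.
elim/tensor_ind: y {x} => [a b|x y IHx IHy]; last first.
  by rewrite !mulrDr linearD /= IHx IHy addr0.
rewrite top_sqE tpureM mul1r /orbit_fun mulrDl linearD /=.
rewrite {1}/Tpoly /Td !tpureM !mul1r etaE.
rewrite mulr_suml linear_sum big_ord_recl big1 => [|i _] /=; last first.
  by rewrite /Tpoly /Tv !tpureM mul1r mulr1 /= mulrA etaE phiL !mul0r mulr0.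
rewrite addr0 /Tpoly /Tv !tpureM mul1r mulr1 mulrA etaE phiL mul1r subrK mul1r.
rewrite -mulrDl -linearD /= -mulrDl dpder1 -weyl_d_poly -mulrA.
by rewrite /fourier_coef fourier_act_d0 mul0r.
Qed.

End MainTheorem.

Theorem theorem1p1 (k : fieldType) (char0 : [pchar k] =i pred0)
    (n : nat) (n_ge2 : (2 <= n)%N) :
  let T : algType k := orbit_alg k n in
  let B : set T := orbit_image n char0 in
  let v : T := Tv k n n.-1 in
  let I : set T := [set x * v ^+ 2 | x in [set: T]] in
  [/\ generates_two_sided [set: T] I (v ^+ 2),
      I `<=` B,
      exists g : T, generates_two_sided B I g,
      ~ fg_left_ideal B I
    & ~ fg_right_ideal B I].
Proof.
case: n n_ge2 => // n n_ge2 /=.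
split.
- exact: top_sq_generates_setT.
- exact: top_sq_ideal_image.
- by exists (Tv k n.+1 n ^+ 2); exact: top_sq_generates_image.
- exact: top_sq_ideal_not_fg_left.
- exact: top_sq_ideal_not_fg_right.
Qed.
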